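(* Let $k\subset\mathbb{R}$ be a subfield and $d$ a natural number. Suppose that the pyramidal growth $\underset{\Delta}{\le}$ coincides with the inclusion order on $\mathbf{Pol}_k(d)$. Then the quasi-pyramidal growth $\underset{\mathbf q}{\le}$ coincides with the inclusion order on $\mathbf{Pol}_k(d+1)$, and moreover $\delta(P,Q)=0$ for any two polytopes $P\subset Q$ in $\mathbf{Pol}_k(d+1)$.
   Context: Work in $\bigoplus_{\mathbb N}\mathbb{R}$ with its Euclidean structure; $d_H$ denotes Hausdorff distance. A polytope is the convex hull of a finite point set; $\mathbf{Pol}_k(n)$ is the set of polytopes of dimension at most $n$ with vertices in $\bigoplus_{\mathbb N}k$. A pyramid over a polytope $P$ is $\operatorname{conv}(P\cup\{v\})$ with $v\notin\operatorname{Aff}(P)$. A pair $P\subset Q$ is a pyramidal extension (written $P\underset{\Delta}{\subset}Q$) if $\Delta=\overline{Q\setminus P}$ is a pyramid and $\Delta\cap P$ is a facet of $\Delta$. The pyramidal growth $\underset{\Delta}{\le}$ on $\mathbf{Pol}_k(n)$ is the partial order generated by pyramidal extensions within $\mathbf{Pol}_k(n)$. A pair $P\subset Q$ in $\mathbf{Pol}_k(n)$ is a quasi-pyramidal growth, $P\underset{\mathbf q}{\le}Q$, if there exist, within $\mathbf{Pol}_k(n)$, polytopes $P=P_0\subset P_1\subset\cdots\subset P_m=Q$ and pyramidal extensions $P_i'\underset{\Delta}{\subset}P_i$ ($i=1,\dots,m$) with $P_0\subset P_i'\subset P_{i-1}$ for all $i$. For $P\underset{\mathbf q}{\le}Q$,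 the quasi-pyramidal defect is $\delta(P,Q)=\inf\sum d_H(P_i',P_i)$, where the infimum is over all such sequences and the sum runs over those indices $i$ with $P_i'\subsetneq P_{i-1}$. *)

(* Defs.v *)
From Stdlib Require Import Relation_Operators.
From HB Require Import structures.
From mathcomp Require Import all_boot all_order all_algebra.
From mathcomp Require Import all_classical all_reals all_analysis.
From mathcomp Require Import ring lra.

Set Implicit Arguments.
Unset Strict Implicit.
Unset Printing Implicit Defensive.
Set Warnings "-redundant-canonical-projection".

Import Order.TTheory GRing.Theory Num.Theory.
Import numFieldNormedType.Exports.

Local Open Scope classical_set_scope.
Local Open Scope ring_scope.

(* The direct sum of countably many copies of R.  A finitely supported real
   sequence is encoded as its list of entries without trailing zeros, which is
   what {poly R} is; only the R-module structure of {poly R} is used. *)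
Definition Rsum (R : realType) : Type := {poly R}.

HB.instance Definition _ (R : realType) :=
  GRing.Lmodule.copy (Rsum R) {poly R}.

Section euclidean.
Context {R : realType}.
Implicit Types (u v w : Rsum R) (a : R).

Definition coord u (i : nat) : R := (u : {poly R})`_i.

(* The terms with index at least size u vanish. *)
Definition dot u v : R :=
  \sum_(i < size (u : {poly R})) coord u i * coord v i.

Definition enorm u : R := Num.sqrt (dot u u).

Lemma coordD u v i : coord (u + v) i = coord u i + coord v i.
Proof. exact: coefD. Qed.

Lemma coordZ a u i : coord (a *: u) i = a * coord u i.
Proof. exact: coefZ. Qed.

Lemma dotE N u v : (size (u : {poly R}) <= N)%N ->
  dot u v = \sum_(i < N) coord u i * coord v i.
Proof.
move=> uN; rewrite /dot (big_ord_widen N (fun i => coord u i * coord v i) uN).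
rewrite big_mkcond; apply: eq_bigr => i _.
by case: ltnP => // ui; rewrite /coord (nth_default 0 ui) mul0r.
Qed.

Lemma dotC u v : dot u v = dot v u.
Proof.
set N := maxn (size (u : {poly R})) (size (v : {poly R})).
rewrite (@dotE N u v) ?leq_maxl// (@dotE N v u) ?leq_maxr//.
by apply: eq_bigr => i _; rewrite mulrC.
Qed.

Lemma dotDr u v w : dot u (v + w) = dot u v + dot u w.
Proof.
by rewrite /dot -big_split; apply: eq_bigr => i _; rewrite coordD mulrDr.
Qed.

Lemma dotZr a u v : dot u (a *: v) = a * dot u v.
Proof.
by rewrite /dot big_distrr; apply: eq_bigr => i _; rewrite coordZ mulrCA.
Qed.

Lemma dotDl u v w : dot (u + v) w = dot u w + dot v w.
Proof. by rewrite dotC dotDr !(dotC w). Qed.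

Lemma dotZl a u v : dot (a *: u) v = a * dot u v.
Proof. by rewrite dotC dotZr (dotC v). Qed.

Lemma dot_ge0 u : 0 <= dot u u.
Proof. by apply: sumr_ge0 => i _; rewrite -expr2 sqr_ge0. Qed.

Lemma dot_eq0 u : dot u u = 0 -> u = 0.
Proof.
move=> u0; apply/polyP => i; rewrite coef0.
have [iu|ui] := ltnP i (size (u : {poly R})); last by rewrite nth_default.
have ge0 (j : 'I_(size (u : {poly R}))) : true -> 0 <= coord u j * coord u j.
  by move=> _; rewrite -expr2 sqr_ge0.
have := psumr_eq0P ge0 u0 (i := Ordinal iu) isT.
by move=> /eqP; rewrite mulf_eq0 orbb => /eqP.
Qed.

Lemma cauchy_schwarz u v : dot u v <= enorm u * enorm v.
Proof.
rewrite /enorm -sqrtrM ?dot_ge0//.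
apply: le_trans (ler_norm _) _; rewrite -sqrtr_sqr ler_sqrt; last first.
  by apply: mulr_ge0; exact: dot_ge0.
have := dot_ge0 (dot v v *: u + (- dot u v) *: v).
rewrite !(dotDl, dotDr, dotZl, dotZr) (dotC v u).
have [v0|v0] := eqVneq (dot v v) 0.
  have uv0 : dot u v = 0 by rewrite (dot_eq0 v0) -(scale0r u) dotZr mul0r.
  by rewrite uv0 v0 expr2 !mulr0.
have vgt0 : 0 < dot v v by rewrite lt_neqAle eq_sym v0 dot_ge0.
set x := dot u u; set y := dot u v; set z := dot v v in vgt0 *.
rewrite (_ : _ + _ = z * (x * z - y ^+ 2)); last by ring.
by rewrite pmulr_rge0// subr_ge0.
Qed.

Lemma enormD u v : enorm (u + v) <= enorm u + enorm v.
Proof.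
rewrite -(@ler_pXn2r _ 2) ?nnegrE ?addr_ge0 ?sqrtr_ge0//.
rewrite sqrrD !sqr_sqrtr ?dot_ge0// !(dotDl, dotDr) (dotC v u).
have := cauchy_schwarz u v; lra.
Qed.

Lemma enormZ a u : enorm (a *: u) = `|a| * enorm u.
Proof.
by rewrite /enorm dotZl dotZr mulrA -expr2 sqrtrM ?sqr_ge0// sqrtr_sqr.
Qed.

Lemma enorm0_eq0 u : enorm u = 0 -> u = 0.
Proof.
move=> /eqP; rewrite sqrtr_eq0 => u0; apply: dot_eq0.
by apply/eqP; rewrite eq_le u0 dot_ge0.
Qed.

End euclidean.

HB.instance Definition _ (R : realType) :=
  Lmodule_isNormed.Build R (Rsum R) (@enormD R) (@enormZ R) (@enorm0_eq0 R).

Section polytopes.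
Context {R : realType}.
Local Notation V := (Rsum R).
Implicit Types (A B F P Q D : set V) (k : {pred R}) (n : nat).

Definition aff A : set V := [set x | exists n (p : 'I_n -> V) (t : 'I_n -> R),
  [/\ forall i, A (p i), \sum_i t i = 1 & x = \sum_i t i *: p i]].

Definition conv A : set V := [set x | exists n (p : 'I_n -> V) (t : 'I_n -> R),
  [/\ forall i, A (p i), forall i, 0 <= t i, \sum_i t i = 1
    & x = \sum_i t i *: p i]].

Definition affinely_independent n (p : 'I_n -> V) : Prop :=
  forall t : 'I_n -> R,
    \sum_i t i = 0 -> \sum_i t i *: p i = 0 -> forall i, t i = 0.

(* Integer-valued, so that the empty set has dimension -1. *)
Definition has_dim A (m : int) : Prop := exists n (p : 'I_n -> V),
  [/\ affinely_independent p, aff (range p) = aff A & m = n%:Z - 1].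

Definition polytope P : Prop := exists2 A, finite_set A & P = conv A.

(* Both P itself and the empty set are faces of P. *)
Definition face P F : Prop := exists (u : V) (c : R),
  (forall x, P x -> dot u x <= c) /\ F = P `&` [set x | dot u x = c].

Definition facet P F : Prop :=
  face P F /\ exists m : int, has_dim P m /\ has_dim F (m - 1).

Definition vertex P (v : V) : Prop := face P [set v].

Definition Pol k n P : Prop :=
  [/\ polytope P,
      exists2 m : int, has_dim P m & m <= n%:Z
    & forall v, vertex P v -> forall i, coord v i \in k].

Definition pyramid D : Prop := exists B (v : V),
  [/\ polytope B, ~ aff B v & D = conv (B `|` [set v])].

Definition pyramidal_extension P Q : Prop :=
  P `<=` Q /\
  let D := closure (Q `\` P) in pyramid D /\ facet D (D `&` P).

Definition pyramidal_growth k n : set V -> set V -> Prop :=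
  clos_refl_trans (set V)
    (fun P Q => [/\ Pol k n P, Pol k n Q & pyramidal_extension P Q]).

(* p 0, ..., p m is the chain P_0, ..., P_m; p' i is P'_i for 1 <= i <= m, and
   the other values of p and p' are irrelevant.  The length m may be 0, which
   accounts for P = Q. *)
Definition quasi_pyramidal_chain k n P Q (m : nat) (p p' : nat -> set V) :=
  [/\ p 0%N = P, p m = Q,
      forall i, (i <= m)%N -> Pol k n (p i)
    & forall i, (1 <= i <= m)%N ->
        [/\ Pol k n (p' i), p i.-1 `<=` p i, pyramidal_extension (p' i) (p i),
            P `<=` p' i & p' i `<=` p i.-1]].

Definition quasi_pyramidal_growth k n P Q : Prop :=
  exists m p p', quasi_pyramidal_chain k n P Q m p p'.

Definition hausdorff_distance A B : \bar R :=
  ereal_inf [set e%:E | e in [set e : R | [/\ 0 <= e,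
    forall a, A a -> exists2 b, B b & `|a - b| <= e
  & forall b, B b -> exists2 a, A a & `|a - b| <= e]]].

Definition quasi_pyramidal_defect k n P Q : \bar R :=
  ereal_inf [set s | exists m p p', quasi_pyramidal_chain k n P Q m p p' /\
    s = (\sum_(1 <= i < m.+1 | `[< p' i `<` p i.-1 >])
          hausdorff_distance (p' i) (p i))%E].

End polytopes.

(* Main.v *)
(* In every dimension the inclusion P `<=` Q is a composition of pyramidal
   extensions; used as a quasi-pyramidal chain, it contributes nothing to the
   defect.

   Homogenization turns polytopes into polyhedral cones over the ordered field
   k, and adding an apex w to C is a pyramidal extension as soon as some linear
   functional h with h w = 1 is nonpositive on C and the projection
   x |-> x - h x *: w maps C into C.  Since C is cut out of D by finitely many
   half-spaces, one may assume C = D `&` [set x | h x <= 0].  Pick X in D with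
   h X > 0 and replace C by R = C + R_+ X: now R and D coincide outside of the
   star of X, that is, R = D `&` (R + R X).  By induction on the dimension
   R + R X grows to D + R X.  For each step of that growth, with apex w, slide w
   along - X until it meets the boundary of D, in a point W.  Adding W is a legal
   step, and what remains to be filled is again a star, with centre W; the
   hyperplanes of D which limit it in the direction of its centre no longer
   include those through W, so that this recursion terminates. *)

From Stdlib Require Import Relation_Operators Operators_Properties.
Require Import Defs.
From HB Require Import structures.
From mathcomp Require Import all_boot all_order all_algebra.
From mathcomp Require Import all_classical all_reals all_analysis.
From mathcomp Require Import ring lra.

Set Implicit Arguments.
Unset Strict Implicit.
Unset Printing Implicit Defensive.

Import Order.TTheory GRing.Theory Num.Theory.
Import numFieldNormedType.Exports.
(* all_analysis has its own conv. *)
Import Defs.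

Local Open Scope classical_set_scope.
Local Open Scope ring_scope.

(** * Growth of polyhedral cones *)

Section cones.
Context {K : realFieldType} {m : nat}.
Local Notation V := 'rV[K]_m.
Implicit Types (l x y w X : V) (C D R Q : set V) (ls J : seq V).

(** Linear forms are encoded as vectors of [V] itself, which makes [ev] symmetric. *)
Definition ev l x : K := (x *m l^T) 0 0.

Lemma evD l x y : ev l (x + y) = ev l x + ev l y.
Proof. by rewrite /ev mulmxDl [LHS]mxE. Qed.

Lemma evZ l a x : ev l (a *: x) = a * ev l x.
Proof. by rewrite /ev -scalemxAl [LHS]mxE. Qed.

Lemma evN l x : ev l (- x) = - ev l x.
Proof. by rewrite -scaleN1r evZ mulN1r. Qed.

Lemma ev0 l : ev l 0 = 0.
Proof. by rewrite -(scale0r 0) evZ mul0r. Qed.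

Lemma evC l x : ev l x = ev x l.
Proof. by rewrite /ev -[in RHS](trmxK l) -trmx_mul [RHS]mxE. Qed.

Definition evE := (evD, evZ, evN, ev0).

Lemma ev_lincomb a b l l' x : ev (a *: l - b *: l') x = a * ev l x - b * ev l' x.
Proof. by rewrite evC !evE !(evC x). Qed.

Lemma evNl l x : ev (- l) x = - ev l x.
Proof. by rewrite evC evN evC. Qed.

Definition polyhedral C :=
  exists ls, forall x, C x <-> (forall l, l \in ls -> 0 <= ev l x).

(** The Minkowski sum of [C] and the ray spanned by [w]. *)
Definition raysum C w : set V := [set x | exists2 t, 0 <= t & C (x - t *: w)].

Lemma polyhedral0 C : polyhedral C -> C 0.
Proof. by move=> [ls lsP]; apply/lsP => l _; rewrite ev0. Qed.

Lemma polyhedralD C x y : polyhedral C -> C x -> C y -> C (x + y).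
Proof.
move=> [ls lsP] /lsP Cx /lsP Cy; apply/lsP => l ll.
by rewrite evD addr_ge0 ?Cx ?Cy.
Qed.

Lemma polyhedralZ C a x : polyhedral C -> 0 <= a -> C x -> C (a *: x).
Proof.
move=> [ls lsP] a0 /lsP Cx; apply/lsP => l ll.
by rewrite evZ mulr_ge0 ?Cx.
Qed.

Lemma polyhedralI C D : polyhedral C -> polyhedral D -> polyhedral (C `&` D).
Proof.
move=> [ls lsP] [ls' lsP']; exists (ls ++ ls') => x; split.
  by move=> [/lsP Cx /lsP' Dx] l; rewrite mem_cat => /orP[/Cx|/Dx].
by move=> H; split; [apply/lsP|apply/lsP'] => l ll; apply: H;
  rewrite mem_cat ll ?orbT.
Qed.

(** Closedness along a segment, obtained algebraically: a form nonnegative at [x] and negative at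
    [x - b *: y] is already negative midway between its zero and [b]. *)
Lemma polyhedral_lim C x y b : polyhedral C ->
  (forall s, 0 <= s -> s < b -> C (x - s *: y)) -> 0 < b -> C (x - b *: y).
Proof.
move=> [ls lsP] H b0.
have cl z l : C z -> l \in ls -> 0 <= ev l z by move=> /lsP; apply.
apply/lsP => l ll; rewrite leNgt; apply/negP => neg.
have Cx : 0 <= ev l x.
  by have := cl _ _ (H 0 (lexx _) b0) ll; rewrite scale0r subr0.
move: neg; rewrite !evE => neg.
have ly : 0 < ev l y by nra.
have := fun t0 tb => cl _ _ (H ((ev l x / ev l y + b) / 2) t0 tb) ll.
have : ev l x / ev l y < b by rewrite ltr_pdivrMr//; lra.
have : 0 <= ev l x / ev l y by rewrite divr_ge0// ltW.
have : ev l x / ev l y * ev l y = ev l x by rewrite divfK// gt_eqF.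
set q := _ / _; move=> qE q0 qb /(_ ltac:(lra) ltac:(lra)).
rewrite !evE; nra.
Qed.

(** A form negative on [- y] would be negative one unit past its zero on the ray. *)
Lemma polyhedral_recession C x y : polyhedral C ->
  (forall s, 0 <= s -> C (x - s *: y)) -> C (- y).
Proof.
move=> [ls lsP] H.
have cl z l : C z -> l \in ls -> 0 <= ev l z by move=> /lsP; apply.
apply/lsP => l ll; rewrite leNgt; apply/negP.
rewrite evN oppr_lt0 => ly.
have Cx : 0 <= ev l x.
  by have := cl _ _ (H 0 (lexx _)) ll; rewrite scale0r subr0.
have := fun t0 => cl _ _ (H (ev l x / ev l y + 1) t0) ll.
have q0 : 0 <= ev l x / ev l y by rewrite divr_ge0// ltW.
move=> /(_ ltac:(lra)); rewrite !evE mulrDl divfK ?gt_eqF//; lra.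
Qed.

(* Fourier-Motzkin elimination of t. *)
Lemma polyhedral_raysum C w : polyhedral C -> polyhedral (raysum C w).
Proof.
move=> [ls lsP].
pose ps := [seq l <- ls | 0 < ev l w].
exists ([seq l <- ls | 0 <= ev l w] ++
  [seq ev l w *: l' - ev l' w *: l | l <- ps, l' <- [seq l <- ls | ev l w < 0]]).
move=> x; split.
  move=> [t t0 /lsP H] l; rewrite mem_cat => /orP[|/allpairsP[[l1 l2]/=]].
    rewrite mem_filter => /andP[lw ll]; have := H _ ll; rewrite !evE; nra.
  rewrite !mem_filter => -[/andP[l1w l1l] /andP[l2w l2l] ->].
  have := H _ l1l; have := H _ l2l; rewrite ev_lincomb !evE; nra.
move=> H.
have H1 l : l \in ls -> 0 <= ev l w -> 0 <= ev l x.
  by move=> ll lw; apply: H; rewrite mem_cat mem_filter lw ll.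
have H2 l l' : l \in ls -> l' \in ls -> 0 < ev l w -> ev l' w < 0 ->
    0 <= ev l w * ev l' x - ev l' w * ev l x.
  move=> ll ll' lw lw'; rewrite -ev_lincomb; apply: H.
  rewrite mem_cat; apply/orP; right; apply/allpairsP; exists (l, l').
  by rewrite !mem_filter ll lw ll' lw'.
suff [t t0 ht] : exists2 t, 0 <= t &
    forall l, l \in ls -> t * ev l w <= ev l x.
  exists t => //; apply/lsP => l ll; rewrite !evE; have := ht _ ll; lra.
(* The forms negative on [w] bound [t] from below, the positive ones from above. Going through the
   former, [t] is raised to each bound that it misses; by [H2] no lower bound exceeds an upper
   one. *)
have tE (t : K) (s : seq V) : {subset s <= ls} -> 0 <= t ->
    (forall l, l \in ls -> 0 < ev l w -> t * ev l w <= ev l x) ->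
    exists2 t', t <= t' & (forall l, l \in s -> ev l w < 0 -> t' * ev l w <= ev l x)
       /\ (forall l, l \in ls -> 0 < ev l w -> t' * ev l w <= ev l x).
  elim: s => [|l s IH] sls t0 tP; first by exists t.
  have [|t' tt' [H3 H4]] := IH _ t0 tP.
    by move=> l' l's; apply: sls; rewrite inE l's orbT.
  have lls : l \in ls by apply: sls; rewrite inE eqxx.
  have [lw|lw] := ltP (ev l w) 0; last first.
    exists t' => //; split=> // l'; rewrite inE => /orP[/eqP->|/H3//].
    by move=> /(le_lt_trans lw); rewrite ltxx.
  have [le|lt] := leP (t' * ev l w) (ev l x).
    by exists t' => //; split=> // l'; rewrite inE => /orP[/eqP->|/H3//].
  exists (ev l x / ev l w).
    by apply: (le_trans tt'); rewrite ler_ndivlMr// ltW.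
  have q : t' <= ev l x / ev l w by rewrite ler_ndivlMr// ltW.
  have qE : ev l x / ev l w * ev l w = ev l x by rewrite divfK// lt_eqF.
  split=> [l'|l' l'l lw'].
    rewrite inE => /orP[/eqP->|l's lw']; first by rewrite qE.
    by apply: le_trans (H3 _ l's lw'); rewrite ler_nM2r.
  have := H2 _ _ l'l lls lw' lw.
  by rewrite -{1}qE => H5; rewrite -(ler_nM2r lw) -subr_ge0; move: H5; lra.
have [|t t0 [H3 H4]] := tE 0 ls (fun _ h => h) (lexx _).
  by move=> l ll lw; rewrite mul0r; apply: H1 => //; exact: ltW.
exists t => // l ll; have [lw|lw|lw] := ltgtP (ev l w) 0; [exact: H3|exact: H4|].
by rewrite lw mulr0; apply: H1; rewrite ?lw.
Qed.


(** The preimage in [V] of the image of [C] modulo [w]; it allows working in the quotient without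
    changing the space. *)
Definition linesum C w : set V := [set x | exists t, C (x - t *: w)].

Lemma polyhedral_linesum C w : polyhedral C -> polyhedral (linesum C w).
Proof.
move=> /(polyhedral_raysum w)/(polyhedral_raysum (- w)); congr polyhedral.
apply/seteqP; split=> x /=.
  move=> [t _ [s _]]; rewrite scalerN opprK -addrA -scalerBl => H.
  by exists (s - t); rewrite -scaleNr opprB.
move=> [t H]; have [t0|t0] := leP 0 t.
  by exists 0 => //; exists t => //; rewrite scale0r subr0.
exists (- t); first by rewrite oppr_ge0 ltW.
by exists 0; rewrite // scale0r subr0 scalerN opprK scaleNr.
Qed.

Lemma raysum_incl C w : C `<=` raysum C w.
Proof. by move=> x Cx; exists 0; rewrite // scale0r subr0. Qed.

Lemma raysum_mem C w : polyhedral C -> raysum C w w.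
Proof. by move=> /polyhedral0 C0; exists 1; rewrite // scale1r subrr. Qed.

Lemma linesum_incl C w : C `<=` linesum C w.
Proof. by move=> x Cx; exists 0; rewrite scale0r subr0. Qed.

(** The homogeneous form of a pyramidal extension: what [raysum C w] adds to [C] lies in the cone
    spanned by [w] and the part of [C] where [h] vanishes. *)
Definition retracts C w h :=
  ev h w = 1 /\ forall x, C x -> ev h x <= 0 /\ C (x - ev h x *: w).

Definition cone_step C D := exists w h, retracts C w h /\ D = raysum C w.

Definition cone_growth : set V -> set V -> Prop := clos_refl_trans (set V) cone_step.

Lemma cone_step_growth C w h : retracts C w h -> cone_growth C (raysum C w).
Proof. by move=> Cwh; apply: rt_step; exists w, h. Qed.

Lemma cone_growth_incl C D : cone_growth C D -> C `<=` D.
Proof.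
elim=> {C D} [C D [w [h [_ ->]]]|C|C D E _ CD _ DE].
- exact: raysum_incl.
- exact: subset_refl.
- exact: subset_trans CD DE.
Qed.

Lemma retracts_raysum C w h y : retracts C w h -> raysum C w y ->
  C (y - ev h y *: w).
Proof.
move=> [hw hC] [t t0 Ct]; have [_] := hC _ Ct.
rewrite !evE hw; congr C; rewrite -addrA -opprD -scalerDl; congr (_ - _ *: _).
ring.
Qed.

(** The points [y - t *: w] and [y - ev h y *: w] lie in [C], and [y] is between them because
    [ev h y <= 0 <= t]. *)
Lemma retracts_raysum_le0 C w h y : polyhedral C -> retracts C w h ->
  raysum C w y -> ev h y <= 0 -> C y.
Proof.
move=> Cp Cwh Cy hy; have Cb := retracts_raysum Cwh Cy.
move: Cwh Cy => [hw hC] [t t0 Ct]; have [] := hC _ Ct.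
rewrite !evE hw mulr1 => hc _.
have [tE|tN] := eqVneq t 0; first by move: Ct; rewrite tE scale0r subr0.
have t1 : 0 < t by rewrite lt_neqAle eq_sym tN.
have d0 : 0 < t - ev h y by lra.
have aE : t / (t - ev h y) * (t - ev h y) = t by rewrite divfK// gt_eqF.
have a0 : 0 <= t / (t - ev h y) by rewrite divr_ge0// ltW.
have a1 : t / (t - ev h y) <= 1 by rewrite ler_pdivrMr//; lra.
set a := t / _ in aE a0 a1.
have -> : y = (1 - a) *: (y - t *: w) + a *: (y - ev h y *: w).
  rewrite !scalerBr !scalerA addrACA -scalerDl subrK scale1r -opprD -scalerDl.
  rewrite -[LHS]subr0; congr (_ - _); rewrite -[LHS](scale0r w); congr (_ *: _).
  by move: aE; lra.
by apply: polyhedralD => //; apply: polyhedralZ => //; lra.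
Qed.

(** * Growth of a cone inside a star *)

Section star.
Variable n : nat.
(** The induction measure is the codimension of a linear subspace [L] contained in the smaller cone:
    passing to the quotient by a line becomes enlarging [L]. *)
Hypothesis IH : forall (L : 'M[K]_m) C D, (m - \rank L < n)%N ->
  polyhedral C -> polyhedral D -> (forall x, (x <= L)%MS -> C x) ->
  C `<=` D -> cone_growth C D.

(* Along -X, a point of Q outside R leaves Q through one of the hyperplanes in J. *)
Definition exits R Q X J := (forall l x, l \in J -> Q x -> 0 <= ev l x) /\
  forall y s, Q y -> ~ R y -> 0 <= s ->
    (forall l, l \in J -> 0 <= ev l (y - s *: X)) -> Q (y - s *: X).

(** The exit occurs at the smallest ratio [ev l q / ev l X] over the forms of [J] positive on [X].
    There is such a form: otherwise the whole ray from [q] would stay in [Q], which would then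
    contain [- X]. *)
Lemma exit_point R Q X J q : polyhedral Q -> Q X -> ~ Q (- X) ->
  exits R Q X J -> Q q -> ~ R q ->
  exists2 s, Q (q - s *: X) & exists2 l, l \in J & ev l (q - s *: X) = 0.
Proof.
move=> Qp QX QNX [J0 JQ] Qq Rq.
pose P s := forall l, l \in J -> 0 <= ev l (q - s *: X).
have [l0 l0J l0X] : exists2 l, l \in J & 0 < ev l X.
  apply: contrapT => H; apply: QNX; apply: (polyhedral_recession (x := q)) => //.
  move=> s s0; apply: JQ => // l lJ; rewrite !evE.
  have lX : ev l X = 0.
    apply/eqP; rewrite eq_le J0// andbT leNgt; apply/negP => lX.
    by apply: H; exists l.
  by rewrite lX mulr0 subr0 J0.
pose f l := ev l q / ev l X.
have [l1 [l1J l1X l1P]] : exists l1, [/\ l1 \in J, 0 < ev l1 X &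
    forall l, l \in J -> 0 < ev l X -> f l1 <= f l].
  pose J' := [seq l <- J | 0 < ev l X].
  have l0J' : l0 \in J' by rewrite mem_filter l0X.
  have [l1 l1J' l1P] : exists2 l1, l1 \in J' & forall l, l \in J' -> f l1 <= f l.
    elim: J' l0 l0J' {l0J l0X} => // l J' IHJ l0 _.
    case: J' IHJ => [_|l' J' IHJ].
      by exists l => [|l']; rewrite inE// => /eqP->.
    have [|l1 l1J l1P] := IHJ l'; first by rewrite inE eqxx.
    have [le|lt] := leP (f l1) (f l).
      exists l1; first by rewrite inE l1J orbT.
      by move=> l2; rewrite inE => /orP[/eqP->//|/l1P].
    exists l; first by rewrite inE eqxx.
    move=> l2; rewrite inE => /orP[/eqP->//|/l1P].
    exact/le_trans/ltW.
  exists l1; move: l1J'; rewrite mem_filter => /andP[-> ->]; split=> // l lJ lX.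
  by apply: l1P; rewrite mem_filter lX.
have fE l : 0 < ev l X -> f l * ev l X = ev l q.
  by move=> lX; rewrite divfK// gt_eqF.
exists (f l1).
  apply: JQ => //; first by rewrite divr_ge0 ?J0.
  move=> l lJ; rewrite !evE.
  have := J0 _ _ lJ QX; rewrite le_eqVlt => /orP[/eqP<-|lX].
    by rewrite mulr0 subr0 J0.
  by rewrite -(fE _ lX) -mulrBl mulr_ge0 ?subr_ge0 ?l1P// ltW.
by exists l1 => //; rewrite !evE fE// subrr.
Qed.

(** The condition on [linesum R X] says that [R] is recovered from its image modulo [X]; a growth of
    images, provided by [IH], is lifted to [Q] step by step. The inner induction is on a bound [k]
    for the size of [J]. *)
Lemma star_growth k J (L : 'M[K]_m) R Q X : (size J <= k)%N ->
  (m - \rank L <= n)%N -> polyhedral R -> polyhedral Q ->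
  (forall x, (x <= L)%MS -> R x) -> R `<=` Q -> R X -> ~ Q (- X) ->
  Q `&` linesum R X `<=` R -> exits R Q X J -> cone_growth R Q.
Proof.
elim: k J R Q X => [|k IHk] J R Q X.
  all: move=> Jk Ln Rp Qp LR RQ RX QNX RE JRQ.
  have [QR|] := pselect (Q `<=` R).
    by have -> : R = Q; [apply/seteqP|exact: rt_refl].
  move=> /existsNP[q /not_implyP[Qq Rq]].
  have [s _ [l]] := exit_point Qp (RQ _ RX) QNX JRQ Qq Rq.
  (* With [J] empty, a point of [Q] outside [R] has no hyperplane to exit through. *)
  by move: Jk; rewrite leqn0 size_eq0 => /eqP->.
have XL : ~~ (X <= L)%MS.
  by apply/negP => XL; apply/QNX/RQ/LR; rewrite eqmx_opp.
pose R' := linesum R X; pose Q' := linesum Q X.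
have R'p : polyhedral R' := polyhedral_linesum X Rp.
have Q'p : polyhedral Q' := polyhedral_linesum X Qp.
(* Modulo [X] the cones contain [L + X], whose rank exceeds that of [L]. *)
have : cone_growth R' Q'.
  apply: (IH (L := (L + X)%MS)) => //.
  - have : (\rank L < \rank (L + X)%MS)%N.
      apply: rank_ltmx; rewrite /ltmx addsmxSl /=.
      by apply: contra XL; apply: submx_trans; exact: addsmxSr.
    move=> rk; apply: leq_trans Ln; apply: ltn_sub2l => //.
    exact: leq_trans rk (rank_leq_row _).
  - move=> x /sub_addsmxP[[u v] /= ->]; exists (v 0 0).
    rewrite {1}[v]mx11_scalar mul_scalar_mx addrK.
    by apply: LR; exact: submxMl.
  - by move=> x [t Rt]; exists t; exact: RQ.
move=> /clos_rt_rt1n_iff.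
have QR' : R = Q `&` R'.
  apply/seteqP; split=> // x Rx; split; [exact: RQ|exact: linesum_incl].
(* The growth of [R'] to [Q'] is followed from its start, each intermediate cone being intersected
   with [Q]. *)
suff H C D : clos_refl_trans_1n _ cone_step C D -> D = Q' -> polyhedral C ->
    R' `<=` C -> cone_growth (Q `&` C) Q.
  by move=> /H/(_ erefl R'p (fun _ => id)); rewrite -QR'.
elim=> {C D} [C -> _ _|C C' D [w [h [Cwh C'E]]] C'D IHC DQ' Cp R'C].
  have -> : Q `&` Q' = Q by apply: setIidl; exact: linesum_incl.
  exact: rt_refl.
have C'p : polyhedral C' by rewrite C'E; exact: polyhedral_raysum.
have CC' : C `<=` C' by rewrite C'E; exact: raysum_incl.
have C'Q' : C' `<=` Q'.
  by rewrite -DQ'; apply: cone_growth_incl; apply/clos_rt_rt1n_iff.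
apply: rt_trans (IHC DQ' C'p _); last exact: subset_trans CC'.
have CX t : C (t *: X).
  by apply: R'C; exists t; rewrite subrr; exact: polyhedral0.
(* [C] contains both [X] and [- X], and [h] is nonpositive on [C]. *)
have hX : ev h X = 0.
  apply/eqP; rewrite eq_le; have [hC1 _] := Cwh.2 _ (CX 1).
  have [hC2 _] := Cwh.2 _ (CX (-1)); move: hC1 hC2; rewrite !evE; lra.
have C'w : C' w by rewrite C'E; exact: raysum_mem.
have [t Qq] := C'Q' _ C'w.
have RC x : R x -> C x by move=> Rx; apply/R'C/linesum_incl.
have Rq : ~ R (w - t *: X).
  by move=> /RC /(Cwh.2)[]; rewrite !evE Cwh.1 hX; lra.
have [s QW [l0 l0J l0W]] := exit_point Qp (RQ _ RX) QNX JRQ Qq Rq.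
(* Sliding along [X] changes neither the value of [h] nor membership in [C'], so [W] can replace [w]
   as apex; it lies in [Q], on the hyperplane of [l0]. *)
set W := _ - s *: X in QW l0W.
have WE : W = w - (t + s) *: X by rewrite scalerDl opprD addrA.
clearbody W.
have hW : ev h W = 1 by rewrite WE !evE Cwh.1 hX; lra.
have C'W : C' W by rewrite WE -scaleNr; apply: polyhedralD => //; exact: CC'.
have C'0 y : C' y -> ev h y <= 0 -> C y.
  by rewrite C'E; exact: retracts_raysum_le0.
have shift y : C (y - ev h y *: w) -> C (y - ev h y *: W).
  move=> Cy; rewrite WE scalerBr opprB addrCA addrC scalerA.
  exact: polyhedralD Cp Cy (CX _).
have C'W0 y : C' y -> C (y - ev h y *: W).
  rewrite C'E => C'y; apply: shift; exact: retracts_raysum.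
have QCp : polyhedral (Q `&` C) := polyhedralI Qp Cp.
have QCW : retracts (Q `&` C) W h.
  split=> // x [Qx /(Cwh.2)[hx Cx]]; split=> //; split; last exact: shift.
  rewrite -scaleNr; apply: polyhedralD => //; apply: polyhedralZ => //.
  by rewrite oppr_ge0.
apply: rt_trans (cone_step_growth QCW) _.
set R1 := raysum _ W; set R2 := Q `&` C'.
have R1p : polyhedral R1 := polyhedral_raysum W QCp.
have R2p : polyhedral R2 := polyhedralI Qp C'p.
have R12 : R1 `<=` R2.
  move=> x [r r0 [Qx Cx]]; rewrite -(subrK (r *: W) x).
  by split; apply: polyhedralD => //; [|exact: CC'|]; apply: polyhedralZ.
have back y : R2 y -> ev h y <= 0 -> R1 y.
  by move=> [Qy C'y] hy; apply: raysum_incl; split=> //; exact: C'0.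
have proj y : R2 y -> 0 <= ev h y -> Q (y - ev h y *: W) -> R1 y.
  by move=> [_ C'y] hy Qy; exists (ev h y) => //; split=> //; exact: C'W0.
(* A star with centre [W] requires [- W] to be outside [R2]; otherwise adding [W] has already filled
   [R2]. *)
have [R2W|R2W] := pselect (R2 (- W)).
  have -> : R1 = R2; last exact: rt_refl.
  apply/seteqP; split=> // y R2y; have [|hy] := leP (ev h y) 0; first exact: back.
  apply: proj => //; first exact: ltW.
  rewrite -scalerN; apply: polyhedralD => //; first by case: R2y.
  by apply: polyhedralZ => //; [exact: ltW|case: R2W].
(* The form [l0] vanishes on [W] and is dropped, so the list becomes strictly shorter. *)
apply: (IHk [seq l <- J | 0 < ev l W]) R1p R2p _ R12 _ R2W _ _ => //.
- rewrite -ltnS; apply: leq_trans Jk.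
  rewrite size_filter ltn_neqAle count_size andbT -all_count.
  by apply/negP => /allP/(_ _ l0J); rewrite l0W ltxx.
- by move=> x /LR Rx; apply: raysum_incl; split; [exact: RQ|exact: RC].
- exact: raysum_mem.
- move=> y [R2y [r1 [r2 _]]]; rewrite -addrA -opprD -scalerDl => Qr.
  have [r0|r0] := leP 0 (r1 + r2); first by exists (r1 + r2).
  apply: back => //; have [_ /(Cwh.2)[]] := Qr.
  by rewrite !evE hW; lra.
have [J0 JQ] := JRQ.
split=> [l x|y r R2y R1y r0 H].
  by rewrite mem_filter => /andP[_ lJ] [Qx _]; exact: J0.
have [Qy C'y] := R2y.
(* The forms dropped from [J] vanish on [W], so moving along [W] does not change their values. *)
have HJ l : l \in J -> 0 <= ev l (y - r *: W).
  move=> lJ; have := J0 _ _ lJ QW; rewrite le_eqVlt => /orP[/eqP lW|lW].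
    by rewrite !evE -lW mulr0 subr0; exact: J0.
  by apply: H; rewrite mem_filter lW.
have hy : 0 < ev h y.
  by rewrite ltNge; apply/negP => hy; apply: R1y; exact: back.
have zC' r' : r' <= ev h y -> C' (y - r' *: W).
  move=> r'y.
  have -> : y - r' *: W = y - ev h y *: W + (ev h y - r') *: W.
    by rewrite scalerBl addrA subrK.
  apply: polyhedralD => //; first by apply: CC'; exact: C'W0.
  by apply: polyhedralZ => //; rewrite subr_ge0.
(* The point [z] is in [C'], hence in [Q'], so that [z + b *: X] is in [Q] for some nonnegative [b].
   It is outside [R], since [h] is positive there. The old star allows returning along [- X] to [z],
   where the forms of [J] are nonnegative. *)
have zQ r' : 0 <= r' -> r' < ev h y -> r' <= r -> Q (y - r' *: W).
  move=> r'0 r'h r'r; have [a Qa] := C'Q' _ (zC' _ (ltW r'h)).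
  set z := y - r' *: W in Qa *.
  pose b := Num.max 0 (- a).
  have b0 : 0 <= b by rewrite le_max lexx.
  have ab : - a <= b by rewrite le_max lexx orbT.
  have Qz : Q (z + b *: X).
    rewrite (_ : _ + _ = z - a *: X + (a + b) *: X); last first.
      by rewrite scalerDl addrA subrK.
    apply: polyhedralD => //; apply: polyhedralZ => //; [lra|exact: RQ].
  rewrite -(addrK (b *: X) z); apply: JQ => //.
    by move=> /RC /(Cwh.2)[]; rewrite !evE hW hX; lra.
  move=> l lJ; rewrite addrK.
  have := HJ _ lJ; have := J0 _ _ lJ Qy; have := J0 _ _ lJ QW.
  by rewrite /z !evE; nra.
have [rh|hr] := ltP r (ev h y).
  by split; [exact: zQ|exact/zC'/ltW].
(* Here the ray reaches the hyperplane where [h] vanishes. [zQ] needs [h] positive, so the point on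
   that hyperplane is reached as a limit; it puts [y] into [R1]. *)
exfalso; apply/R1y/proj => //; first exact: ltW.
apply: polyhedral_lim => // r' r'0 r'h; apply: zQ => //.
exact/(le_trans (ltW r'h)).
Qed.

End star.

(** The half-spaces of [C] are dropped one at a time: [E s] is [D] cut by the forms in [s] only. The
    growth from [E (l :: s)] to [E s] adds one apex beyond the hyperplane of [l] and then fills a
    star. *)
Lemma cone_growth_polyhedral (L : 'M[K]_m) C D : polyhedral C -> polyhedral D ->
  (forall x, (x <= L)%MS -> C x) -> C `<=` D -> cone_growth C D.
Proof.
have [n] := ubnP (m - \rank L); elim: n L C D => // n IH L C D.
rewrite ltnS => Ln Cp Dp LC CD.
have [ls lsP] := Cp.
pose E (s : seq V) := D `&` [set x | forall l, l \in s -> 0 <= ev l x].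
have Ep s : polyhedral (E s) by apply: polyhedralI => //; exists s.
have CE s : {subset s <= ls} -> C `<=` E s.
  by move=> sls x Cx; split; [exact: CD|move=> l /sls; exact: (lsP x).1].
have -> : C = E ls.
  by apply/seteqP; split=> [|x [_ /lsP//]]; exact: CE.
suff H s : {subset s <= ls} -> cone_growth (E s) D by exact: H.
elim: s => [_|l s IHs sls].
  by rewrite (_ : E [::] = D); [exact: rt_refl|apply/seteqP; split=> [x []|]].
have sls' : {subset s <= ls} by move=> l' l's; apply: sls; rewrite inE l's orbT.
apply: rt_trans (IHs sls').
have [[X EX lX]|noX] := pselect (exists2 X, E s X & ev l X < 0); last first.
  suff -> : E (l :: s) = E s by exact: rt_refl.
  apply/seteqP; split=> x [Dx H]; split=> // l'.
    by move=> l's; apply: H; rewrite inE l's orbT.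
  rewrite inE => /orP[/eqP->|/H//]; rewrite leNgt; apply/negP => lx.
  by apply: noX; exists x.
pose X' := (- (ev l X)^-1) *: X.
have EX' : E s X'.
  by apply: polyhedralZ => //; rewrite oppr_ge0 invr_le0 ltW.
have lX' : ev l X' = -1 by rewrite evZ mulNr mulVf// lt_eqF.
clearbody X'.
have EE : E (l :: s) `<=` E s.
  by move=> x [Dx H]; split=> // l' l's; apply: H; rewrite inE l's orbT.
have El x : E s x -> 0 <= ev l x -> E (l :: s) x.
  by move=> [Dx H] lx; split=> // l'; rewrite inE => /orP[/eqP->|/H].
have lE x : E (l :: s) x -> 0 <= ev l x by move=> [_]; apply; rewrite inE eqxx.
have ret : retracts (E (l :: s)) X' (- l).
  split=> [|x Ex]; first by rewrite evNl lX' opprK.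
  rewrite evNl oppr_le0 scaleNr opprK; split; first exact: lE.
  apply: El; last by rewrite !evE lX' mulrN1 subrr.
  apply: polyhedralD => //; first exact: EE.
  by apply: polyhedralZ => //; exact: lE.
apply: rt_trans (cone_step_growth ret) _.
have Rp : polyhedral (raysum (E (l :: s)) X') := polyhedral_raysum X' (Ep _).
have RE : raysum (E (l :: s)) X' `<=` E s.
  move=> x [t t0 /EE Ex]; rewrite -(subrK (t *: X') x).
  by apply: polyhedralD => //; exact: polyhedralZ.
have ER x : E s x -> 0 <= ev l x -> raysum (E (l :: s)) X' x.
  by move=> Ex lx; apply: raysum_incl; exact: El.
(* If [- X'] is in [E s], each point where [l] is negative slides along [- X'] to the hyperplane of
   [l], and the first step has filled [E s]. *)
have [ENX|ENX] := pselect (E s (- X')).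
  have -> : raysum (E (l :: s)) X' = E s; last exact: rt_refl.
  apply/seteqP; split=> // x Ex; have [|lx] := leP 0 (ev l x); first exact: ER.
  exists (- ev l x); first by rewrite oppr_ge0 ltW.
  apply: El; last by rewrite !evE lX'; lra.
  rewrite -scalerN; apply: polyhedralD => //; apply: polyhedralZ => //.
  by rewrite oppr_ge0 ltW.
(* Initially [J] consists of all the forms defining [E s]. *)
have [J JP] := Ep s.
apply: (star_growth (n := n) IH (leqnn (size J)) Ln Rp (Ep s)) => //.
- move=> x /LC Cx; apply: raysum_incl; exact: (CE _ sls).
- exact: raysum_mem.
- exact: ENX.
- move=> x [Ex [t [r _]]]; rewrite -addrA -opprD -scalerDl => Er.
  have [r0|r0] := leP 0 (t + r); first by exists (t + r).
  by apply: ER => //; have := lE _ Er; rewrite !evE lX'; lra.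
- split=> [l' x l'J|y r _ _ _ H]; first by move=> /JP; apply.
  exact/(JP _).2.
Qed.

(** Built by repeated [raysum], so that Weyl's theorem, [polyhedral_cone_of], is an induction on
    [polyhedral_raysum]. *)
Fixpoint cone_of (s : seq V) : set V :=
  if s is w :: s' then raysum (cone_of s') w else [set 0].

Lemma polyhedral_cone_of s : polyhedral (cone_of s).
Proof.
elim: s => [|w s IHs]; last exact: polyhedral_raysum.
exists ([seq delta_mx 0 i | i <- enum 'I_m] ++
  [seq - delta_mx 0 i | i <- enum 'I_m]).
have evd i x : ev (delta_mx 0 i) x = x 0 i.
  rewrite /ev mxE (bigD1 i)//= big1 ?addr0; first by rewrite !mxE !eqxx mulr1.
  by move=> j /negPf ji; rewrite !mxE ji andbF mulr0.
move=> x; split=> [-> l _|H]; first by rewrite ev0.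
apply/rowP => i; rewrite mxE; apply/eqP; rewrite eq_le.
have H1 : 0 <= ev (delta_mx 0 i) x.
  apply: H; rewrite mem_cat; apply/orP; left.
  by apply/mapP; exists i; rewrite ?mem_enum.
have H2 : 0 <= ev (- delta_mx 0 i) x.
  apply: H; rewrite mem_cat; apply/orP; right.
  by apply/mapP; exists i; rewrite ?mem_enum.
by move: H1 H2; rewrite evNl !evd oppr_ge0 => -> ->.
Qed.

Lemma cone_of_mem s w : w \in s -> cone_of s w.
Proof.
elim: s => //= w' s IHs; rewrite inE => /orP[/eqP->|/IHs].
  exact/raysum_mem/polyhedral_cone_of.
exact: raysum_incl.
Qed.

Lemma cone_of_min s C : polyhedral C -> {in s, forall w, C w} -> cone_of s `<=` C.
Proof.
move=> Cp; elim: s => [_ _ ->|w s IHs sC x [t t0 Cx]]; first exact: polyhedral0.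
rewrite -(subrK (t *: w) x); apply: polyhedralD => //.
  by apply: IHs Cx => w' w's; apply: sC; rewrite inE w's orbT.
by apply: polyhedralZ => //; apply: sC; rewrite inE eqxx.
Qed.

End cones.

(** * Convex hulls, affine hulls and dimension *)

Section convexity.
Context {R : realType}.
Local Notation V := (Rsum R).
Implicit Types (A B C : set V) (x y w : V).

Definition convex C := forall x y t, C x -> C y -> 0 <= t -> t <= 1 ->
  C ((1 - t) *: x + t *: y).

Lemma conv_incl A : A `<=` conv A.
Proof.
move=> x Ax; exists 1%N, (fun=> x), (fun=> 1); split=> //.
  by rewrite big_ord1.
by rewrite big_ord1 scale1r.
Qed.

Lemma subset_conv A B : A `<=` B -> conv A `<=` conv B.
Proof.
move=> AB x [n [p [t [pA t0 t1 ->]]]]; exists n, p, t; split=> // i.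
exact: AB.
Qed.

Lemma conv0 : conv (set0 : set V) = set0.
Proof.
apply/seteqP; split=> // x [[|n] [p [t [pA _ + _]]]].
  by rewrite big_ord0 => /esym/eqP; rewrite oner_eq0.
by have := pA ord0.
Qed.

Lemma convex_conv A : convex (conv A).
Proof.
move=> x y a [n [p [t [pA t0 t1 ->]]]] [m [q [s [qA s0 s1 ->]]]] a0 a1.
exists (n + m)%N,
  (fun i => match fintype.split i with inl j => p j | inr j => q j end),
  (fun i => match fintype.split i with
            | inl j => (1 - a) * t j | inr j => a * s j end).
split.
- by move=> i; case: (fintype.split i).
- by move=> i; case: (fintype.split i) => j; rewrite mulr_ge0// subr_ge0.
- rewrite big_split_ord /=.
  under eq_bigr do rewrite (unsplitK (inl _)).
  under [X in _ + X]eq_bigr do rewrite (unsplitK (inr _)).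
  by rewrite -!mulr_sumr t1 s1 !mulr1 subrK.
- rewrite big_split_ord /= !scaler_sumr.
  congr (_ + _); apply: eq_bigr => i _.
    by rewrite (unsplitK (inl _)) scalerA.
  by rewrite (unsplitK (inr _)) scalerA.
Qed.

Lemma convex_sum C n (p : 'I_n -> V) t : convex C -> (forall i, C (p i)) ->
  (forall i, 0 <= t i) -> \sum_i t i = 1 -> C (\sum_i t i *: p i).
Proof.
move=> Cc; elim: n p t => [|n IH] p t pC t0.
  by rewrite big_ord0 => /esym/eqP; rewrite oner_eq0.
rewrite !big_ord_recl => t1.
have ss0 : 0 <= \sum_(i < n) t (lift ord0 i) by apply: sumr_ge0.
have [sE|sN] := eqVneq (\sum_(i < n) t (lift ord0 i)) 0.
  have tE i : t (lift ord0 i) = 0 by apply: (psumr_eq0P _ sE).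
  rewrite [X in _ + X]big1 ?addr0; last by move=> i _; rewrite tE scale0r.
  by move: t1; rewrite sE addr0 => ->; rewrite scale1r.
move: t1; set s := \sum_(i < n) t _ in ss0 sN * => t1.
have Cs : C (\sum_(i < n) (s^-1 * t (lift ord0 i)) *: p (lift ord0 i)).
  apply: IH => [i|i|]; first exact: pC.
    by rewrite mulr_ge0// invr_ge0.
  by rewrite -mulr_sumr mulVf.
have := Cc _ _ s (pC ord0) Cs ss0.
rewrite (_ : 1 - s = t ord0); last by lra.
rewrite scaler_sumr.
under eq_bigr do rewrite scalerA mulrA divff// mul1r.
by apply; have := t0 ord0; lra.
Qed.

Lemma conv_min A C : convex C -> A `<=` C -> conv A `<=` C.
Proof.
by move=> Cc sAC x [n [p [t [pA t0 t1 ->]]]]; apply: convex_sum => // i; exact: sAC.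
Qed.

Lemma convP A B : A `<=` conv B -> conv A `<=` conv B.
Proof. by move=> AB; apply: conv_min => //; exact: convex_conv. Qed.

Lemma coordP x y : (forall i, coord x i = coord y i) -> x = y.
Proof. by move=> xy; apply/polyP. Qed.

Lemma coordN x i : coord (- x) i = - coord x i.
Proof. exact: coefN. Qed.

Definition coordE := (@coordD R, @coordZ R, coordN).

(** The union of the segments from [conv A] to [w] is convex. The first alternative serves the case
    of an empty [A]. *)
Lemma conv_setU1 A w y : conv (A `|` [set w]) y ->
  y = w \/ exists x t, [/\ conv A x, 0 <= t, t <= 1 & y = (1 - t) *: x + t *: w].
Proof.
have [->|/set0P[x0 Ax0]] := eqVneq A set0.
  rewrite set0U => wy; left; move: y wy; apply: conv_min => // _ _ t -> -> _ _.
  by rewrite -scalerDl subrK scale1r.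
move=> wy; right; move: y wy; apply: conv_min => [y z a|y].
  move=> [x [t [Ax t0 t1 ->]]] [x' [t' [Ax' t'0 t'1 ->]]] a0 a1.
  pose T := (1 - a) * t + a * t'.
  have b0 : 0 <= a * (1 - t') by rewrite mulr_ge0// subr_ge0.
  have c0 : 0 <= (1 - a) * (1 - t) by rewrite mulr_ge0// subr_ge0.
  (* [T] is the total weight of [w]. When it is 1, any point of [conv A] will do. *)
  have [T1|T1] := eqVneq (1 - T) 0.
    exists x, 1; split=> //; apply/coordP => i; rewrite !coordE.
    have bE : a * (1 - t') = 0 by move: T1; rewrite /T; lra.
    have cE : (1 - a) * (1 - t) = 0 by move: T1; rewrite /T; lra.
    transitivity ((1 - a) * (1 - t) * coord x i + a * (1 - t') * coord x' i
      + T * coord w i); first by rewrite /T; ring.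
    by rewrite bE cE (_ : T = 1); [ring|lra].
  have T0 : 0 < 1 - T by rewrite lt_neqAle eq_sym T1 /T; lra.
  exists ((1 - a * (1 - t') / (1 - T)) *: x + (a * (1 - t') / (1 - T)) *: x'), T.
  split=> //.
  - apply: convex_conv => //; first by rewrite divr_ge0// ltW.
    by rewrite ler_pdivrMr// /T; lra.
  - by rewrite /T addr_ge0 ?mulr_ge0 ?subr_ge0.
  - by lra.
  - apply/coordP => i; rewrite !coordE /T; field.
    by rewrite /T in T1; rewrite T1.
move=> [Ay|->].
  exists y, 0; split; rewrite ?subr0 ?scale1r ?scale0r ?addr0//.
  exact: conv_incl.
exists x0, 1; split; rewrite ?subrr ?scale1r ?scale0r ?add0r//.
exact: conv_incl.
Qed.

Lemma dotN u x : dot (- u) x = - dot u x.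
Proof. by rewrite -scaleN1r dotZl mulN1r. Qed.

Lemma affine_formP (c : R) u x y t :
  c + dot u ((1 - t) *: x + t *: y) =
  (1 - t) * (c + dot u x) + t * (c + dot u y).
Proof. by rewrite dotDr !dotZr; ring. Qed.

(** A convex combination of nonpositive numbers vanishes only if every term of positive weight
    does. *)
Lemma conv_face A (c : R) u : (forall a, A a -> c + dot u a <= 0) ->
  conv A `&` [set x | c + dot u x = 0] = conv (A `&` [set x | c + dot u x = 0]).
Proof.
move=> A0; apply/seteqP; split=> [x [Ax xE]|].
  suff : conv A `<=` [set x | c + dot u x <= 0 /\ (c + dot u x = 0 ->
      conv (A `&` [set x | c + dot u x = 0]) x)].
    by move=> /(_ _ Ax)[_ /(_ xE)].
  apply: conv_min => [y z t [y0 yP] [z0 zP] t0 t1|y Ay] /=.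
    rewrite affine_formP; split.
      by rewrite -oppr_ge0 opprD -!mulrN addr_ge0 ?mulr_ge0 ?oppr_ge0 ?subr_ge0.
    move=> E; have [tE|tN] := eqVneq t 0.
      rewrite tE subr0 scale1r scale0r addr0; apply: yP.
      by move: E; rewrite tE subr0 mul1r mul0r addr0.
    have [tE|tN1] := eqVneq (1 - t) 0.
      have t1E : t = 1 by lra.
      rewrite tE t1E scale1r scale0r add0r; apply: zP.
      by move: E; rewrite t1E subrr mul0r mul1r add0r.
    have tp : 0 < t by rewrite lt_neqAle eq_sym tN.
    have tp1 : 0 < 1 - t by rewrite lt_neqAle eq_sym tN1 subr_ge0.
    by apply: convex_conv => //; [apply: yP|apply: zP]; nra.
  by split=> [|yE]; [exact: A0|exact: conv_incl].
move=> x Ax; split; first by apply: subset_conv Ax => y [].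
move: x Ax; apply: conv_min => [y z t yE zE _ _|x []//] /=.
by rewrite affine_formP yE zE !mulr0 addr0.
Qed.

(** By [conv_face], the singleton of [v] is the hull of the points of [A] on the supporting
    hyperplane; such a point exists and is [v]. *)
Lemma vertex_conv A v : vertex (conv A) v -> A v.
Proof.
move=> [u [c [uc vE]]].
have E : conv A `&` [set x | dot u x = c] = conv A `&` [set x | - c + dot u x = 0].
  by congr (_ `&` _); apply/seteqP; split=> x /= H; lra.
rewrite E conv_face in vE; last first.
  by move=> a Aa; have := uc _ (conv_incl Aa); lra.
have [A0|/set0P[a [Aa ac]]] :=
    eqVneq (A `&` [set x | - c + dot u x = 0]) set0.
  by move: vE; rewrite A0 conv0 => /seteqP[/(_ v erefl)].
have : [set v] a by rewrite vE; exact: conv_incl.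
by move=> <-.
Qed.

(** With three points, an affine combination can be built one difference [p i - x0] at a time, with
    no constraint on the partial sums of weights. *)
Definition affine C := forall x y z t, C x -> C y -> C z -> C (x + t *: (y - z)).

Lemma aff_incl A : A `<=` aff A.
Proof.
move=> x Ax; exists 1%N, (fun=> x), (fun=> 1); split=> //.
  by rewrite big_ord1.
by rewrite big_ord1 scale1r.
Qed.

Lemma subset_aff A B : A `<=` B -> aff A `<=` aff B.
Proof.
by move=> AB x [n [p [t [pA t1 ->]]]]; exists n, p, t; split=> // i; exact: AB.
Qed.

Lemma affine_sum C x0 n (p : 'I_n -> V) t : affine C -> C x0 ->
  (forall i, C (p i)) -> C (x0 + \sum_i t i *: (p i - x0)).
Proof.
move=> Cc Cx0; elim: n p t => [|n IH] p t pC; first by rewrite big_ord0 addr0.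
rewrite big_ord_recr addrA; apply: Cc => //; exact: IH.
Qed.

Lemma affine_min A C : affine C -> A `<=` C -> aff A `<=` C.
Proof.
move=> Cc sAC x [n [p [t [pA t1 ->]]]].
case: n p t pA t1 => [|n] p t pA t1.
  by move: t1; rewrite big_ord0 => /esym/eqP; rewrite oner_eq0.
have -> : \sum_i t i *: p i = p ord0 + \sum_i t i *: (p i - p ord0).
  under [X in _ = _ + X]eq_bigr do rewrite scalerBr.
  by rewrite sumrB -scaler_suml t1 scale1r addrC subrK.
by apply: affine_sum => // [|i]; exact: sAC.
Qed.

Lemma aff_range n (q : 'I_n -> V) x : aff (range q) x ->
  exists t, \sum_i t i = 1 /\ x = \sum_i t i *: q i.
Proof.
move: x; apply: affine_min.
  move=> _ _ _ a [t [t1 ->]] [s [s1 ->]] [r [r1 ->]].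
  exists (fun i => t i + a * (s i - r i)); split.
    by rewrite big_split /= -mulr_sumr sumrB t1 s1 r1 subrr mulr0 addr0.
  rewrite -sumrB scaler_sumr -big_split; apply: eq_bigr => i _ /=.
  by rewrite scalerDl -scalerA scalerBl.
move=> _ [i _ <-]; exists (fun j => (i == j)%:R); split.
  by rewrite (bigD1 i)//= eqxx big1 ?addr0// => j /negPf; rewrite eq_sym => ->.
rewrite (bigD1 i)//= eqxx scale1r big1 ?addr0// => j /negPf.
by rewrite eq_sym => ->; rewrite scale0r.
Qed.

Lemma aff_range_sum n (q : 'I_n -> V) t :
  \sum_i t i = 1 -> aff (range q) (\sum_i t i *: q i).
Proof. by move=> t1; exists n, q, t; split=> // i; exists i. Qed.

Lemma affine_aff_range n (q : 'I_n -> V) : affine (aff (range q)).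
Proof.
move=> x y z a /aff_range[t [t1 ->]] /aff_range[s [s1 ->]] /aff_range[r [r1 ->]].
rewrite (_ : _ + _ = \sum_i (t i + a * (s i - r i)) *: q i).
  apply: aff_range_sum.
  by rewrite big_split /= -mulr_sumr sumrB t1 s1 r1 subrr mulr0 addr0.
rewrite -sumrB scaler_sumr -big_split; apply: eq_bigr => i _ /=.
by rewrite scalerDl -scalerA scalerBl.
Qed.

Lemma aff_sub_range A n (q : 'I_n -> V) :
  A `<=` aff (range q) -> aff A `<=` aff (range q).
Proof. by move=> Aq; apply: affine_min => //; exact: affine_aff_range. Qed.

(** If [n' < n], the matrix of barycentric coordinates of [p] over [q] has a nonzero left kernel
    vector, which is an affine dependence of [p]. *)
Lemma independent_leq n n' (p : 'I_n -> V) (q : 'I_n' -> V) :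
  affinely_independent p -> (forall i, aff (range q) (p i)) -> (n <= n')%N.
Proof.
move=> pI pq.
have {pq} /choice[T TP] i := aff_range (pq i).
rewrite leqNgt; apply/negP => n'n.
pose M : 'M[R]_(n, n') := \matrix_(i, j) T i j.
have : kermx M != 0.
  rewrite -mxrank_eq0 mxrank_ker subn_eq0 -ltnNge.
  exact: leq_ltn_trans (rank_leq_col M) _.
move=> /rowV0Pn[u /sub_kermxP uM /eqP]; apply.
have uT j : \sum_i u 0 i * T i j = 0.
  have := congr1 (fun m : 'rV_n' => m 0 j) uM; rewrite !mxE => uMj.
  by rewrite -[RHS]uMj; apply: eq_bigr => i _; rewrite mxE.
apply/rowP => i; rewrite mxE; apply: pI => //.
  transitivity (\sum_i \sum_j u 0 i * T i j).
    by apply: eq_bigr => k _; rewrite -mulr_sumr (TP k).1 mulr1.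
  by rewrite exchange_big /= big1.
transitivity (\sum_i \sum_j (u 0 i * T i j) *: q j).
  apply: eq_bigr => k _; rewrite {1}(TP k).2 scaler_sumr.
  by apply: eq_bigr => j _; rewrite scalerA.
by rewrite exchange_big big1// => j _; rewrite -scaler_suml uT scale0r.
Qed.

Definition fcons n w (p : 'I_n -> V) : 'I_n.+1 -> V :=
  fun i => if unlift ord0 i is Some j then p j else w.

Lemma fcons0 n w (p : 'I_n -> V) : fcons w p ord0 = w.
Proof. by rewrite /fcons unlift_none. Qed.

Lemma fconsS n w (p : 'I_n -> V) i : fcons w p (lift ord0 i) = p i.
Proof. by rewrite /fcons liftK. Qed.

Lemma fcons_in n w (p : 'I_n -> V) C : C w -> (forall i, C (p i)) ->
  forall i, C (fcons w p i).
Proof. by move=> Cw Cp i; rewrite /fcons; case: unlift. Qed.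

Lemma independent_fcons n (p : 'I_n -> V) w :
  affinely_independent p -> ~ aff (range p) w -> affinely_independent (fcons w p).
Proof.
move=> pI wp t; rewrite !big_ord_recl fcons0.
move=> t0; under [X in _ + X = 0 -> _]eq_bigr do rewrite fconsS.
move=> tp.
have [tE|tN] := eqVneq (t ord0) 0.
  rewrite tE add0r in t0; rewrite tE scale0r add0r in tp => i.
  by case: (unliftP ord0 i) => [j|] -> //; exact: (pI _ t0 tp).
case: wp.
have -> : w = \sum_i (- (t ord0)^-1 * t (lift ord0 i)) *: p i.
  under eq_bigr do rewrite -scalerA.
  rewrite -scaler_sumr -[X in _ *: X](addKr (t ord0 *: w)) tp addr0.
  by rewrite scalerN scaleNr opprK scalerA mulVf// scale1r.
apply: aff_range_sum; rewrite -mulr_sumr.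
rewrite (_ : \sum_i _ = - t ord0); last by move: t0; lra.
by rewrite mulrNN mulVf.
Qed.

(** An independent family in [A] of maximal size; a point outside its affine hull could be added to
    it. *)
Lemma affine_basis A n' (q : 'I_n' -> V) : A `<=` aff (range q) ->
  exists n (p : 'I_n -> V), [/\ (n <= n')%N, affinely_independent p,
    forall i, A (p i) & A `<=` aff (range p)].
Proof.
move=> Aq.
pose P n := `[< exists2 p : 'I_n -> V, affinely_independent p & forall i, A (p i) >].
have Pn n : P n -> (n <= n')%N.
  move=> /asboolP[p pI pA]; apply: independent_leq pI _ => i; exact/Aq.
have P0 : exists n, P n.
  exists 0%N; apply/asboolP; exists (fun=> 0); first by move=> t _ _ [].
  by case.
case: (ex_maxnP P0 Pn) => n Pnn nmax; have /asboolP[p pI pA] := Pnn.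
exists n, p; split=> //; first exact: Pn.
move=> w Aw; apply: contrapT => wp.
have : P n.+1.
  apply/asboolP; exists (fcons w p); first exact: independent_fcons.
  exact: fcons_in.
by move=> /nmax; rewrite ltnn.
Qed.

Lemma has_dim_basis A n (p : 'I_n -> V) : affinely_independent p ->
  (forall i, A (p i)) -> A `<=` aff (range p) -> has_dim A (n%:Z - 1).
Proof.
move=> pI pA Ap; exists n, p; split=> //; apply/seteqP; split.
  by apply: subset_aff => _ [i _ <-].
exact: aff_sub_range.
Qed.

Lemma finite_aff_range A : finite_set A ->
  exists n (q : 'I_n -> V), A `<=` range q.
Proof.
move=> /finite_seqP[s ->]; exists (size s), (fun i => nth 0 s i) => x /= xs.
have xi : (index x s < size s)%N by rewrite index_mem.
by exists (Ordinal xi); rewrite //= nth_index.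
Qed.

Lemma has_dim_subset A B (m : int) : A `<=` B -> has_dim B m ->
  exists2 m', has_dim A m' & m' <= m.
Proof.
move=> AB [n' [q [_ qB ->]]].
have [|n [p [nn' pI pA Ap]]] := @affine_basis A n' q.
  by rewrite qB => x /AB/aff_incl.
exists (n%:Z - 1); first exact: (has_dim_basis pI pA Ap).
by rewrite lerD2r lez_nat.
Qed.

End convexity.

(** * Polytopes as sections of cones *)

Section transfer.
Context {R : realType} {K : realFieldType} (f : {rmorphism K -> R}).
Hypothesis f_le : {mono f : x y / x <= y}.
Variable N : nat.
Local Notation V := (Rsum R).
Local Notation W := 'rV[K]_N.+1.
Implicit Types (v w h : W) (s : seq W).

(* The point of R^N whose homogeneous coordinates (height first) are v, not
   divided by the height. *)
Definition pt v : V := \poly_(i < N) f (v 0 (inord i.+1)).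

Lemma coord_pt v i : coord (pt v) i = if (i < N)%N then f (v 0 (inord i.+1)) else 0.
Proof. by rewrite /coord coef_poly. Qed.

Lemma ptD v w : pt (v + w) = pt v + pt w.
Proof.
apply/coordP => i; rewrite coordD !coord_pt; case: ifP => _; last by rewrite addr0.
by rewrite mxE rmorphD.
Qed.

Lemma ptZ a v : pt (a *: v) = f a *: pt v.
Proof.
apply/coordP => i; rewrite coordZ !coord_pt; case: ifP => _; last by rewrite mulr0.
by rewrite mxE rmorphM.
Qed.

(** At height one a linear form over [K] becomes a real affine form, with the height coefficient as
    constant term. *)
Lemma rmorph_ev h v : f (ev h v) = f (h 0 0) * f (v 0 0) + dot (pt h) (pt v).
Proof.
rewrite /ev mxE rmorph_sum big_ord_recl /= rmorphM mxE mulrC; congr (_ + _).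
rewrite (dotE (N := N)) ?size_poly//; apply: eq_bigr => i _ /=.
rewrite !coord_pt ltn_ord rmorphM mxE mulrC.
by rewrite (_ : inord _ = lift ord0 i)//; apply/val_inj; rewrite /= inordK// ltnS.
Qed.

Lemma rmorph_ge0 a : (0 <= f a) = (0 <= a).
Proof. by rewrite -(rmorph0 f) f_le. Qed.

Lemma rmorph_gt0 a : (0 < f a) = (0 < a).
Proof. by rewrite !lt_neqAle rmorph_ge0 [in LHS]eq_sym fmorph_eq0 eq_sym. Qed.

Definition pts s : set V := [set pt v | v in [set` s]].

Lemma finite_pts s : finite_set (pts s).
Proof. exact/finite_image/finite_seq. Qed.

Lemma pts_cons w s : pts (w :: s) = pts s `|` [set pt w].
Proof.
apply/seteqP; split=> x /=.
  by move=> [v /=]; rewrite inE => /orP[/eqP->|vs] <-; [right|left; exists v].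
by move=> [[v vs <-]|->]; [exists v|exists w]; rewrite //= inE ?eqxx// vs orbT.
Qed.

Definition height1 s := {in s, forall v, v 0 0 = 1}.

(** Adding [t *: w] to a vector of height [a] moves its dehomogenization towards [pt w], with weight
    [t / (a + t)]. *)
Lemma cone_of_conv s v : height1 s -> cone_of s v ->
  v = 0 \/ 0 < v 0 0 /\ conv (pts s) ((f (v 0 0))^-1 *: pt v).
Proof.
elim: s v => [|w s IHs] v s1; first by move=> ->; left.
have w1 : w 0 0 = 1 by apply: s1; rewrite inE eqxx.
have {}s1 : height1 s by move=> u us; apply: s1; rewrite inE us orbT.
move=> [t t0 /(IHs _ s1)]; rewrite pts_cons.
have Cs : conv (pts s) `<=` conv (pts s `|` [set pt w]).
  by apply: subset_conv => x; left.
have Cw : conv (pts s `|` [set pt w]) (pt w) by apply: conv_incl; right.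
have [->|tN] := eqVneq t 0.
  by rewrite scale0r subr0 => -[->|[v0 /Cs]]; [left|right].
have {tN}t0 : 0 < t by rewrite lt_neqAle eq_sym tN.
have -> : v 0 0 = (v - t *: w) 0 0 + t by rewrite !mxE w1 mulr1 subrK.
move=> [vE|[v'0 Cv']]; right.
  have vtw : v = t *: w by apply/eqP; rewrite -subr_eq0 vE.
  rewrite vE mxE add0r vtw; split=> //; rewrite ptZ scalerA mulVf ?scale1r//.
  by rewrite gt_eqF// rmorph_gt0.
move: v'0 Cv'; set v' := v - _ => v'0 Cv'; split; first by rewrite addr_gt0.
have -> : v = v' + t *: w by rewrite subrK.
rewrite -rmorph_gt0 in v'0; rewrite -rmorph_gt0 in t0.
rewrite ptD ptZ rmorphD; set a := f (v' 0 0) in v'0 Cv' *; set b := f t in t0 *.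
have ab : 0 < a + b by rewrite addr_gt0.
have -> : (a + b)^-1 *: (pt v' + b *: pt w) =
   (1 - b / (a + b)) *: (a^-1 *: pt v') + (b / (a + b)) *: pt w.
  by apply/coordP => i; rewrite !coordE; field; rewrite !gt_eqF.
apply: convex_conv => //; first exact: Cs.
- by rewrite divr_ge0// ltW.
- by rewrite ler_pdivrMr// mul1r lerDr ltW.
Qed.

(* Weyl's theorem over K, transported along f. *)
Lemma cone_of_separation s v : height1 s -> v 0 0 = 1 -> ~ cone_of s v ->
  exists u (c : R), (forall w, w \in s -> dot u (pt w) <= c) /\ c < dot u (pt v).
Proof.
move=> s1 v1; have [ls lsP] := polyhedral_cone_of s.
move=> /lsP/existsNP[l /not_implyP[ll /negP]]; rewrite -ltNge => lv.
exists (- pt l), (f (l 0 0)).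
split=> [w ws|].
  have : 0 <= ev l w by apply: (lsP w).1 ll; exact: cone_of_mem.
  by rewrite -rmorph_ge0 rmorph_ev (s1 _ ws) rmorph1 mulr1 dotN; lra.
have : f (ev l v) < 0 by rewrite ltNge rmorph_ge0 -ltNge.
by rewrite rmorph_ev v1 rmorph1 mulr1 dotN; lra.
Qed.

End transfer.

Section homogenization.
Context {R : realType} {K : realFieldType} (f : {rmorphism K -> R}).
Variables (g : R -> K) (N : nat).
Local Notation V := (Rsum R).

(** Index 0 holds the height, which shifts the coordinates of [x] by one. *)
Definition homogenize (x : V) : 'rV[K]_N.+1 :=
  \row_i (if i == ord0 then 1 else g (coord x i.-1)).

Lemma homogenize_height x : homogenize x 0 0 = 1.
Proof. by rewrite mxE. Qed.

Lemma pt_homogenize (x : V) : (size (x : {poly R}) <= N)%N ->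
  (forall i, f (g (coord x i)) = coord x i) -> pt f (homogenize x) = x.
Proof.
move=> xN gx; apply/coordP => i; rewrite coord_pt; case: ltnP => iN.
  rewrite mxE -val_eqE /= inordK ?ltnS//= gx //.
by rewrite /coord nth_default//; exact: leq_trans iN.
Qed.

End homogenization.

(** * Separation, closures and vertices *)

Section topology.
Context {R : realType}.
Local Notation V := (Rsum R).
Implicit Types (A B C : set V) (x y w u : V).

Lemma conv_set1 x : conv [set x] = [set x].
Proof.
apply/seteqP; split; last exact: conv_incl.
by apply: conv_min => // _ _ t -> -> _ _; rewrite -scalerDl subrK scale1r.
Qed.

Lemma convex_halfspace u (c : R) : convex [set x | c + dot u x <= 0].
Proof. by move=> x y t /= x0 y0 t0 t1; rewrite affine_formP; nra. Qed.

(** The case of [cone_of_separation] where [K] is [R] and [f] the identity; [N] bounds the supports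
    of all points involved. *)
Lemma conv_separation A x : finite_set A -> ~ conv A x ->
  exists u (c : R), (forall a, A a -> dot u a <= c) /\ c < dot u x.
Proof.
move=> /finite_seqP[s ->] sx.
pose N := \max_(a <- x :: s) size (a : {poly R}).
have aN a : a \in x :: s -> (size (a : {poly R}) <= N)%N.
  move=> as_; rewrite /N.
  exact: (@leq_bigmax_seq _ _ xpredT (fun a : V => size (a : {poly R}))).
pose h := homogenize (idfun : R -> R) N.
have ptK a : a \in x :: s -> pt (idfun : {rmorphism R -> R}) (h a) = a.
  by move=> /aN aN'; apply: pt_homogenize.
have ptsE : pts (idfun : {rmorphism R -> R}) [seq h a | a <- s] = [set` s].
  apply/seteqP; split=> [_ [_ /= /mapP[a as_ ->] <-]|a as_].
    by rewrite /= ptK// inE as_ orbT.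
  exists (h a); first by rewrite /= map_f.
  by rewrite ptK// inE as_ orbT.
have h1 : height1 [seq h a | a <- s].
  by move=> _ /mapP[a _ ->]; exact: homogenize_height.
have idP : {mono (idfun : {rmorphism R -> R}) : a b / a <= b} by [].
have [|u [c [us cx]]] :=
  @cone_of_separation R R idfun idP N _ (h x) h1 (homogenize_height _ _ _).
  move=> /(cone_of_conv idP h1)[/rowP/(_ 0)|[_]].
    by rewrite homogenize_height mxE => /eqP; rewrite oner_eq0.
  by rewrite ptsE homogenize_height invr1 scale1r ptK// inE eqxx.
exists u, c; split=> [a as_|].
  by rewrite -(ptK a) ?inE ?as_ ?orbT//; apply: us; rewrite map_f.
by rewrite -[x in dot _ x]ptK// inE eqxx.
Qed.

Lemma closure_halfspace C u (c : R) x : (forall y, C y -> dot u y <= c) ->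
  closure C x -> dot u x <= c.
Proof.
move=> Cc Cx; rewrite leNgt; apply/negP => cx.
(* The [+ 1] keeps the radius meaningful when [u] is zero. *)
have u0 : 0 < enorm u + 1 by rewrite ltr_wpDl// sqrtr_ge0.
have e0 : 0 < (dot u x - c) / (enorm u + 1) by rewrite divr_gt0// subr_gt0.
have [y [/Cc yc]] := Cx _ (nbhsx_ballx x _ e0).
rewrite -ball_normE /= => xy.
have := cauchy_schwarz u (x - y).
rewrite dotDr -scaleN1r dotZr mulN1r.
have : enorm (x - y) < (dot u x - c) / (enorm u + 1) := xy.
rewrite ltr_pdivlMr// scaleN1r => lt.
have : 0 <= enorm (x - y) by exact: sqrtr_ge0.
have : 0 <= enorm u by exact: sqrtr_ge0.
nra.
Qed.

Lemma closure_conv A : finite_set A -> closure (conv A) `<=` conv A.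
Proof.
move=> Afin x Ax; apply: contrapT => /(conv_separation Afin)[u [c [uc]]].
rewrite ltNge => /negP; apply; apply: closure_halfspace Ax => y Ay.
suff : [set x | - c + dot u x <= 0] y by move=> /=; lra.
apply: conv_min Ay; first exact: convex_halfspace.
by move=> a /uc /=; lra.
Qed.

(** Points lying in the hull of the others are discarded. Each remaining point is strictly separated
    from the hull of the others, and the separating form exposes it as a vertex. *)
Lemma polytope_vertices P : polytope P ->
  exists2 s : seq V, P = conv [set` s] & {in s, forall a, vertex P a}.
Proof.
move=> [_ /finite_seqP[s ->] ->].
have [n] := ubnP (size s); elim: n s => // n IH s; rewrite ltnS => sn.
pose s' a := [seq b <- s | b != a].
have s'_set a : [set` s' a] = [set` s] `\ a.
  apply/seteqP; split=> b /=; rewrite mem_filter.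
    by move=> /andP[/eqP ba bs].
  by move=> [bs /eqP ->].
have [[a as_ ca]|H] := pselect (exists2 a, a \in s & conv [set` s' a] a).
  have -> : conv [set` s] = conv [set` s' a].
    apply/seteqP; split; apply: convP => b.
      have [->//|ba] := eqVneq b a.
      by move=> bs; apply: conv_incl; rewrite /= mem_filter ba.
    by rewrite s'_set => -[bs _]; exact: conv_incl.
  apply: IH; apply: leq_trans sn.
  rewrite size_filter ltn_neqAle count_size andbT -all_count.
  by apply/negP => /allP/(_ _ as_); rewrite /= eqxx.
exists s => // a as_.
have /(conv_separation (finite_seq _))[u [c [uc ca]]] : ~ conv [set` s' a] a.
  by move=> ca; apply: H; exists a.
have sa b : b \in s -> - dot u a + dot u b <= 0.
  have [->|ba bs] := eqVneq b a; first by rewrite addNr.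
  have : dot u b <= c by apply: uc; rewrite /= mem_filter ba.
  by lra.
exists u, (dot u a); split.
  move=> x sx; suff : [set x | - dot u a + dot u x <= 0] x by move=> /=; lra.
  by apply: conv_min sx => //; exact: convex_halfspace.
rewrite (_ : [set x | _] = [set x | - dot u a + dot u x = 0]); last first.
  by apply/seteqP; split=> x /= ?; lra.
rewrite conv_face// -[LHS]conv_set1; congr conv.
apply/seteqP; split=> [_ ->|b [bs]] /=; first by rewrite addNr.
move=> bE; apply: contrapT => /eqP ba.
have : dot u b <= c by apply: uc; rewrite /= mem_filter ba.
by lra.
Qed.

End topology.

(** * Pyramidal extensions *)

Section pyramid.
Context {R : realType}.
Local Notation V := (Rsum R).
Variables (A : set V) (u w : V) (c : R).
Let al (x : V) := c + dot u x.
Hypothesis Afin : finite_set A.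
Hypothesis alw : al w = 1.
(** The dehomogenized form of [retracts]: the second point is where the line through [a] and [w]
    meets the hyperplane on which [al] vanishes. *)
Hypothesis step : forall a, A a ->
  al a <= 0 /\ conv A ((1 - al a)^-1 *: (a - al a *: w)).

Let al_comb x y t : al ((1 - t) *: x + t *: y) = (1 - t) * al x + t * al y.
Proof. exact: affine_formP. Qed.

(** Central projection from [w] maps segments to segments, the weights being rescaled by
    [1 - al]. *)
Let step_conv x : conv A x ->
  al x <= 0 /\ conv A ((1 - al x)^-1 *: (x - al x *: w)).
Proof.
move: x; apply: (@conv_min _ _ [set x | al x <= 0 /\
  conv A ((1 - al x)^-1 *: (x - al x *: w))]) => //.
move=> x y t [x0 Cx] [y0 Cy] t0 t1 /=; rewrite al_comb.
set a := al x in x0 Cx *; set b := al y in y0 Cy *.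
have s0 : (1 - t) * a + t * b <= 0 by nra.
split=> //.
have d0 : 0 < 1 - ((1 - t) * a + t * b) by lra.
have [a1 b1] : 1 - a != 0 /\ 1 - b != 0 by split; apply: lt0r_neq0; lra.
have tb : 0 <= t * (1 - b) by apply: mulr_ge0 => //; lra.
have ta : 0 <= (1 - t) * (1 - a) by apply: mulr_ge0; lra.
have -> : (1 - ((1 - t) * a + t * b))^-1 *:
    ((1 - t) *: x + t *: y - ((1 - t) * a + t * b) *: w) =
  (1 - t * (1 - b) / (1 - ((1 - t) * a + t * b))) *: ((1 - a)^-1 *: (x - a *: w))
  + (t * (1 - b) / (1 - ((1 - t) * a + t * b))) *: ((1 - b)^-1 *: (y - b *: w)).
  by apply/coordP => i; rewrite !coordE; field; rewrite a1 b1 gt_eqF.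
apply: convex_conv => //; first by rewrite divr_ge0// ltW.
by rewrite ler_pdivrMr//; lra.
Qed.

Let B := A `&` [set x | al x = 0].

Let conv_base : conv A `&` [set x | al x = 0] = conv B.
Proof. by apply: conv_face => a /step[]. Qed.

Let D := conv (B `|` [set w]).

Let pyramid_ge0 x : D x -> 0 <= al x.
Proof.
move: x; apply: (@conv_min _ _ [set x | 0 <= al x]).
  by move=> x y t /= x0 y0 t0 t1; rewrite al_comb addr_ge0// mulr_ge0// subr_ge0.
by move=> x [[_ /= ->]//|->]; rewrite /= alw.
Qed.

Let DI : D `&` [set x | al x = 0] = conv B.
Proof.
have E : [set x | al x = 0] = [set x | - c + dot (- u) x = 0].
  by apply/seteqP; split=> x /=; rewrite dotN /al => ?; lra.
rewrite E /D conv_face -?E.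
  congr conv; apply/seteqP; split=> [x [[//|->]]|x Bx].
    by rewrite /= alw => /eqP; rewrite oner_eq0.
  by split; [left|case: Bx].
move=> a; rewrite dotN => -[[_ /=]|->]; first by rewrite /al; lra.
by have := alw; rewrite /al; lra.
Qed.

Let Q := conv (A `|` [set w]).

Let PQ : conv A `<=` Q. Proof. by apply: subset_conv => x; left. Qed.

Let DQ : D `<=` Q.
Proof. by apply: subset_conv => x [[Ax _]|]; [left|right]. Qed.

(** The segment from [x] to [w] crosses the hyperplane at [x'], a point of the base. Up to [x'] it
    stays in [conv A], and after [x'] it is in the pyramid. *)
Let cover : Q `\` conv A `<=` D.
Proof.
move=> y [/conv_setU1[->|[x [t [Ax t0 t1 yE]]]] nAy].
  by apply: conv_incl; right.
have [x0 Ax'] := step_conv Ax; set x' := _ *: _ in Ax'.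
have d0 : 0 < 1 - al x by lra.
have dN : 1 - al x != 0 by rewrite gt_eqF.
have alx' : al x' = 0.
  rewrite /al /x' dotZr dotDr -scaleNr dotZr.
  have -> : dot u w = 1 - c by have := alw; rewrite /al; lra.
  have -> : dot u x = al x - c by rewrite /al; lra.
  by field.
have Bx' : conv B x' by rewrite -conv_base.
have alyE : al y = (1 - t) * al x + t by rewrite yE al_comb alw mulr1.
have [y0|y0] := leP (al y) 0; last first.
  have -> : y = (1 - al y) *: x' + al y *: w.
    by rewrite alyE yE /x'; apply/coordP => i; rewrite !coordE; field.
  apply: convex_conv; [|by apply: conv_incl; right|exact: ltW|].
    by apply: subset_conv Bx' => z; left.
  by rewrite alyE; nra.
have [xE|xN] := eqVneq (al x) 0.
  have tE : t = 0 by move: y0; rewrite alyE xE mulr0 add0r; lra.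
  by case: nAy; rewrite yE tE subr0 scale1r scale0r addr0.
have xm : al x < 0 by rewrite lt_neqAle xN.
case: nAy.
have -> : y = (1 - t * (1 - al x) / (- al x)) *: x +
    (t * (1 - al x) / (- al x)) *: x'.
  rewrite yE /x'; apply/coordP => i; rewrite !coordE; field.
  by rewrite ?dN ?xN.
apply: convex_conv => //.
  by rewrite divr_ge0 ?oppr_ge0// mulr_ge0// ltW.
by rewrite ler_pdivrMr ?oppr_gt0//; move: y0; rewrite alyE; nra.
Qed.

Let Bfin : finite_set B. Proof. exact: finite_setIl. Qed.

Let closureD : closure (Q `\` conv A) = D.
Proof.
apply/seteqP; split.
  apply: subset_trans (closure_subset cover) _; apply: closure_conv.
  by rewrite finite_setU; split=> //; exact: finite_set1.
move=> x Dx U /nbhs_ballP[e e0 eU].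
(* A point of [D] is approached by points slightly closer to [w], where [al] is positive. The [+ 1]
   avoids a zero divisor and makes the final estimate strict. *)
pose d := `|x - w| + 1.
have d0 : 0 < d by rewrite ltr_wpDl.
pose t := Num.min 1 (e / d).
have ed : 0 < e / d by rewrite divr_gt0.
have t0 : 0 < t by rewrite lt_min ltr01.
have t1 : t <= 1 by rewrite ge_min lexx.
have te : t <= e / d by rewrite ge_min lexx orbT.
exists ((1 - t) *: x + t *: w); split.
  split.
    apply: convex_conv => //; [exact: DQ|by apply: conv_incl; right|exact: ltW].
  move=> /step_conv[]; rewrite al_comb alw mulr1.
  by have := pyramid_ge0 Dx; nra.
apply: eU; rewrite -ball_normE /=.
have -> : x - ((1 - t) *: x + t *: w) = t *: (x - w).
  by apply/coordP => i; rewrite !coordE; ring.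
rewrite normrZ gtr0_norm//.
have : t * d <= e by rewrite -ler_pdivlMr.
rewrite /d mulrDr mulr1; lra.
Qed.

(** The pyramid meets [conv A] in its base because [al] is nonnegative on the former and nonpositive
    on the latter. An affine basis of the base, extended by [w], is one of the pyramid. *)
Lemma pyramidal_extension_conv :
  pyramidal_extension (conv A) (conv (A `|` [set w])).
Proof.
split; first exact: PQ.
rewrite -/Q closureD /=.
have DA : D `&` conv A = conv B.
  rewrite -DI; apply/seteqP; split=> x [Dx xA]; split=> //.
    by apply/eqP; rewrite eq_le pyramid_ge0// (step_conv xA).1.
  have : conv B x by rewrite -DI.
  by rewrite -conv_base => -[].
have aff0 C x : C `<=` [set x | al x = 0] -> aff C x -> al x = 0.
  move=> C0; move: x; apply: (@affine_min _ _ [set x | al x = 0]) => //.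
  move=> x y z t /=; rewrite /al dotDr dotZr dotDr -scaleN1r dotZr => x0 y0 z0.
  have -> : dot u y = - c by lra.
  have -> : dot u z = - c by lra.
  have -> : dot u x = - c by lra.
  by ring.
have B0 x : conv B x -> al x = 0 by rewrite -DI => -[].
have wB C : C `<=` [set x | al x = 0] -> ~ aff C w.
  by move=> C0 /(aff0 _ _ C0)/eqP; rewrite alw oner_eq0.
split.
  exists (conv B), w; split; [by exists B|by apply: wB => x /B0|].
  apply/seteqP; split; apply: convP.
    move=> x [Bx|->]; apply: conv_incl; [left; exact: conv_incl|by right].
  move=> x [Bx|->]; last by apply: conv_incl; right.
  by apply: subset_conv Bx => y; left.
rewrite DA; split.
  exists (- u), c; split=> [x /pyramid_ge0|].
    by rewrite dotN /al; lra.
  rewrite -DI; congr (_ `&` _); apply/seteqP.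
  by split=> x /=; rewrite dotN /al => ?; lra.
have [n' [q Bq]] := finite_aff_range Bfin.
have Bq' : conv B `<=` aff (range q).
  apply: conv_min => [x y t qx qy _ _|x /Bq]; last exact: aff_incl.
  have -> : (1 - t) *: x + t *: y = x + t *: (y - x).
    by apply/coordP => i; rewrite !coordE; ring.
  exact: affine_aff_range.
have [n [p [_ pI pB Bp]]] := affine_basis Bq'.
(* The base has dimension [n - 1]; if it is empty, [n] is 0 and the pyramid is the point [w]. *)
exists n; split; last exact: has_dim_basis pI pB Bp.
have -> : n = n.+1%:Z - 1 :> int by rewrite -addn1 PoszD addrK.
apply: (has_dim_basis (p := fcons w p)).
- apply: independent_fcons => //; apply: wB => _ [i _ <-]; exact: B0.
- apply: fcons_in; first by apply: conv_incl; right.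
  by move=> i; apply: subset_conv (pB i) => y; left.
- apply: conv_min.
    move=> x y t qx qy _ _.
    have -> : (1 - t) *: x + t *: y = x + t *: (y - x).
      by apply/coordP => i; rewrite !coordE; ring.
    exact: affine_aff_range.
  move=> x [Bx|->]; last by apply: aff_incl; exists ord0; rewrite // fcons0.
  have : aff (range p) x by apply/Bp/conv_incl.
  apply: subset_aff => _ [i _ <-]; exists (lift ord0 i) => //.
  by rewrite fconsS.
Qed.

End pyramid.

(** * A subfield of the reals as an ordered field *)

Section subfield.
Context {R : realType} {k : {pred R}}.

(* k_subfield is an argument so that it can be recovered from the type below. *)
Definition subfield_pred (_ : divring_closed k) : {pred R} := k.

Variable k_subfield : divring_closed k.

Record subfield_type :=
  Subfield { subfield_val : R; _ : subfield_val \in subfield_pred k_subfield }.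

HB.instance Definition _ := [isSub for subfield_val].
HB.instance Definition _ := [Choice of subfield_type by <:].
HB.instance Definition _ :=
  GRing.SubChoice_isSubIntegralDomain.Build R (subfield_pred k_subfield)
    subfield_type k_subfield.
HB.instance Definition _ := [SubIntegralDomain_isSubField of subfield_type by <:].

Local Notation f := (val : {rmorphism subfield_type -> R}).
Implicit Types x y : subfield_type.

Definition subfield_le x y := val x <= val y.
Definition subfield_lt x y := val x < val y.
Definition subfield_norm x := if subfield_le 0 x then x else - x.

Lemma subfield_le0_add x y :
  subfield_le 0 x -> subfield_le 0 y -> subfield_le 0 (x + y).
Proof. by rewrite /subfield_le !(rmorphD f, rmorph0 f); exact: addr_ge0. Qed.

Lemma subfield_le0_mul x y :
  subfield_le 0 x -> subfield_le 0 y -> subfield_le 0 (x * y).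
Proof. by rewrite /subfield_le (rmorphM f) (rmorph0 f); exact: mulr_ge0. Qed.

Lemma subfield_le0_anti x : subfield_le 0 x -> subfield_le x 0 -> x = 0.
Proof.
rewrite /subfield_le => x0 x0'; apply: val_inj; apply/eqP.
by rewrite eq_le x0 x0'.
Qed.

Lemma subfield_sub_ge0 x y : subfield_le 0 (y - x) = subfield_le x y.
Proof. by rewrite /subfield_le (rmorphB f) (rmorph0 f) subr_ge0. Qed.

Lemma subfield_le0_total x : subfield_le 0 x || subfield_le x 0.
Proof. exact: le_total. Qed.

Lemma subfield_normN x : subfield_norm (- x) = subfield_norm x.
Proof.
rewrite /subfield_norm /subfield_le (rmorphN f) (rmorph0 f) oppr_ge0 opprK.
case: (ltgtP 0 (val x)) => // x0.
have -> : x = 0 by apply: val_inj; rewrite -x0 (rmorph0 f).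
by rewrite oppr0.
Qed.

Lemma subfield_ge0_norm x : subfield_le 0 x -> subfield_norm x = x.
Proof. by rewrite /subfield_norm => ->. Qed.

Lemma subfield_lt_def x y : subfield_lt x y = (y != x) && subfield_le x y.
Proof. by rewrite /subfield_lt lt_def. Qed.

HB.instance Definition _ := Num.IntegralDomain_isLeReal.Build subfield_type
  subfield_le0_add subfield_le0_mul subfield_le0_anti subfield_sub_ge0
  subfield_le0_total subfield_normN subfield_ge0_norm subfield_lt_def.

Lemma subfield_val_le : {mono (f : subfield_type -> R) : x y / x <= y}.
Proof. by []. Qed.

End subfield.

(** * Growth of polytopes *)

Section growth.
Context {R : realType} {K : realFieldType} (f : {rmorphism K -> R}).
Hypothesis f_le : {mono f : x y / x <= y}.
Variables (k : {pred R}) (N n : nat).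
Hypothesis f_k : forall a, f a \in k.
Local Notation V := (Rsum R).
Local Notation W := 'rV[K]_N.+1.
Implicit Types (v w h : W) (s : seq W) (D : set W).

Lemma Pol_pts s (Q : set V) m : conv (pts f s) `<=` Q -> has_dim Q m ->
  m <= n%:Z -> Pol k n (conv (pts f s)).
Proof.
move=> sQ Qm mn; split.
- by exists (pts f s) => //; exact: finite_pts.
- have [m' sm' m'm] := has_dim_subset sQ Qm.
  by exists m' => //; exact: le_trans m'm mn.
- move=> _ /vertex_conv[v _ <-] i; rewrite coord_pt; case: ifP => // _.
  by rewrite -(rmorph0 f).
Qed.

(** Each cone step dehomogenizes to a pyramidal extension. The condition on heights in [D] puts
    every apex at positive height, and containment in [Q] bounds the dimensions. *)
Lemma cone_growth_pyramidal D (Q : set V) m C s : convex Q -> has_dim Q m ->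
  m <= n%:Z -> (forall v, D v -> v = 0 \/ 0 < v 0 0) ->
  (forall v, D v -> v 0 0 = 1 -> Q (pt f v)) ->
  cone_growth C D -> C = cone_of s -> height1 s ->
  exists s', [/\ height1 s', D = cone_of s' &
    pyramidal_growth k n (conv (pts f s)) (conv (pts f s'))].
Proof.
move=> Qc Qm mn D0 DQ /clos_rt_rt1n_iff CD.
elim: CD s D0 DQ => {C D} [C|C C' D [w [h [Cwh C'E]]] C'D IH] s D0 DQ CE s1.
  by exists s; split=> //; exact: rt_refl.
have C'sD : C' `<=` D by apply: cone_growth_incl; apply/clos_rt_rt1n_iff.
have Cp : polyhedral C by rewrite CE; exact: polyhedral_cone_of.
have [hw hC] := Cwh.
have w0 : 0 < w 0 0.
  have [|wE|//] := D0 w; first by apply: C'sD; rewrite C'E; exact: raysum_mem.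
  by move: hw; rewrite wE ev0 => /esym/eqP; rewrite oner_eq0.
have wN : w 0 0 != 0 by rewrite gt_eqF.
(* The apex is scaled to height one and [h] inversely, which preserves the projection along the
   apex. *)
pose w' := (w 0 0)^-1 *: w; pose h' := w 0 0 *: h.
have evh' v : ev h' v = w 0 0 * ev h v by rewrite evC evZ evC.
have evw' v : ev h' v *: w' = ev h v *: w.
  by rewrite evh' scalerA mulrAC mulfV// mul1r.
have w'1 : w' 0 0 = 1 by rewrite mxE mulVf.
have hw' : ev h' w' = 1 by rewrite evh' evZ hw mulr1 mulfV.
have C'E' : C' = cone_of (w' :: s).
  rewrite C'E CE /=; apply/seteqP; split=> x [t t0 Ct].
    exists (t * w 0 0); first by rewrite mulr_ge0// ltW.
    by rewrite scalerA mulfK.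
  exists (t * (w 0 0)^-1); first by rewrite mulr_ge0// invr_ge0 ltW.
  by rewrite -scalerA.
have s1' : height1 (w' :: s) by move=> v; rewrite inE => /orP[/eqP->|/s1].
have [s'] := IH _ D0 DQ C'E' s1'; case=> s'1 DE growth.
exists s'; split=> //; apply: rt_trans growth; apply: rt_step.
have sQ : conv (pts f (w' :: s)) `<=` Q.
  apply: conv_min => // _ [v /= vs <-]; apply: DQ; last exact: s1'.
  by apply: C'sD; rewrite C'E'; exact: cone_of_mem.
split.
- apply: Pol_pts Qm mn; apply: subset_trans sQ; apply: subset_conv.
  by rewrite pts_cons => x; left.
- exact: Pol_pts Qm mn.
rewrite pts_cons.
have alE v : v 0 0 = 1 -> f (h' 0 0) + dot (pt f h') (pt f v) = f (ev h' v).
  by move=> v1; rewrite rmorph_ev v1 rmorph1 mulr1.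
apply: (@pyramidal_extension_conv _ _ (pt f h') _ (f (h' 0 0))).
- exact: finite_pts.
- by rewrite alE// hw' rmorph1.
move=> _ [v /= vs <-]; rewrite alE ?s1//.
have Cvs : C v by rewrite CE; exact: cone_of_mem.
have [hv Cv] := hC v Cvs.
have hv' : ev h' v <= 0 by rewrite evh' pmulr_rle0.
split; first by rewrite -oppr_ge0 -rmorphN rmorph_ge0// oppr_ge0.
rewrite -evw' CE in Cv.
have vE : (v - ev h' v *: w') 0 0 = 1 - ev h' v.
  by rewrite !mxE (s1 _ vs) mulVf// mulr1.
have := cone_of_conv f_le s1 Cv; rewrite vE => -[/rowP/(_ 0)|[_]].
  by rewrite vE mxE; lra.
by rewrite ptD -scaleNr ptZ rmorphN scaleNr rmorphB rmorph1.
Qed.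

End growth.

(** Vertices are lifted to height one over the ordered field [k]. By separation, inclusion of the
    polytopes gives inclusion of the cones, whose growth is then transported back. *)
Theorem pyramidal_growth_incl (R : realType) (k : {pred R}) (n : nat)
    (P Q : set (Rsum R)) : divring_closed k ->
  Pol k n P -> Pol k n Q -> P `<=` Q -> pyramidal_growth k n P Q.
Proof.
move=> k_subfield [Pp _ Pk] [Qp [m Qm mn] Qk] PQ.
have [sP PE sPv] := polytope_vertices Pp.
have [sQ QE sQv] := polytope_vertices Qp.
pose K := subfield_type k_subfield.
pose f : {rmorphism K -> R} := val.
have f_le : {mono f : x y / x <= y} by move=> x y; exact: subfield_val_le.
have f_k (a : K) : f a \in k by exact: (valP a).
(* The default 0 is harmless: only coordinates of vertices are lifted, and they are in [k]. *)
pose g (x : R) : K := insubd 0 x.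
have fg x : x \in k -> f (g x) = x by move=> xk; apply: insubdK.
pose N := \max_(a <- sP ++ sQ) size (a : {poly R}).
have ptK a : a \in sP ++ sQ -> pt f (homogenize g N a) = a.
  move=> as_; apply: pt_homogenize => [|i].
    exact: (@leq_bigmax_seq _ _ xpredT (fun a : Rsum R => size (a : {poly R}))).
  apply: fg; move: as_; rewrite mem_cat => /orP[/sPv/Pk|/sQv/Qk]; exact.
have ptsE s : {subset s <= sP ++ sQ} ->
    pts f [seq homogenize g N a | a <- s] = [set` s].
  move=> ss; apply/seteqP; split=> [_ [_ /= /mapP[a as_ ->] <-]|a as_].
    by rewrite /= ptK// ss.
  by exists (homogenize g N a); [rewrite /= map_f|rewrite ptK// ss].
have sPs : {subset sP <= sP ++ sQ} by move=> a; rewrite mem_cat => ->.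
have sQs : {subset sQ <= sP ++ sQ} by move=> a; rewrite mem_cat => ->; rewrite orbT.
have h1 s : height1 [seq homogenize g N a | a <- s].
  by move=> _ /mapP[a _ ->]; exact: homogenize_height.
set A := [seq homogenize g N a | a <- sP]; set B := [seq homogenize g N a | a <- sQ].
have AE : conv (pts f A) = P by rewrite ptsE.
have BE : conv (pts f B) = Q by rewrite ptsE.
have AB : cone_of A `<=` cone_of B.
  apply: cone_of_min; first exact: polyhedral_cone_of.
  move=> v vA; apply: contrapT => /(cone_of_separation f_le (h1 _) (h1 _ _ vA)).
  move=> [u [c [uc]]]; rewrite ltNge => /negP; apply.
  suff : [set x | - c + dot u x <= 0] (pt f v) by move=> /=; lra.
  have : Q (pt f v) by apply: PQ; rewrite -AE; apply: conv_incl; exists v.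
  rewrite -BE; apply: conv_min; first exact: convex_halfspace.
  by move=> _ [b /uc /= ? <-]; lra.
have growth : cone_growth (cone_of A) (cone_of B).
  apply: (cone_growth_polyhedral (L := 0)) => //; try exact: polyhedral_cone_of.
  by move=> x; rewrite submx0 => /eqP->; apply: polyhedral0; exact: polyhedral_cone_of.
have BQ v : cone_of B v -> v 0 0 = 1 -> Q (pt f v).
  move=> /(cone_of_conv f_le (h1 _))[->|[_ +] v1].
    by rewrite mxE => /esym/eqP; rewrite oner_eq0.
  by rewrite v1 rmorph1 invr1 scale1r -BE.
have B0 v : cone_of B v -> v = 0 \/ 0 < v 0 0.
  by move=> /(cone_of_conv f_le (h1 _))[->|[? _]]; [left|right].
have Qc : convex Q by rewrite -BE; exact: convex_conv.
have [s [s1 sE]] := cone_growth_pyramidal f_le f_k Qc Qm mn B0 BQ growth erefl (h1 _).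
rewrite AE (_ : conv (pts f s) = Q)//.
apply/seteqP; split.
  apply: conv_min => // _ [v vs <-]; apply: BQ; last exact: s1.
  by rewrite sE; exact: cone_of_mem.
rewrite -BE; apply: convP => _ [v vB <-].
have /(cone_of_conv f_le s1)[vE|[_]] : cone_of s v by rewrite -sE; exact: cone_of_mem.
  by have := h1 _ _ vB; rewrite vE mxE => /esym/eqP; rewrite oner_eq0.
by rewrite (h1 _ _ vB) rmorph1 invr1 scale1r.
Qed.

(** Taking [p' i] equal to [p i.-1] leaves no index with a strict inclusion, hence no contribution
    to the defect. *)
Lemma pyramidal_growth_chain (R : realType) (k : {pred R}) (n : nat)
    (P Q : set (Rsum R)) : Pol k n P -> pyramidal_growth k n P Q ->
  exists m p, quasi_pyramidal_chain k n P Q m p (fun i => p i.-1).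
Proof.
move=> Pp /clos_rt_rt1n_iff growth; elim: growth Pp => {P Q} [P Pp|].
  by exists 0%N, (fun=> P); split=> // [[]].
move=> P P1 Q [_ P1p ext] _ /(_ P1p)[m [p [p0 pm pPol pext]]] Pp.
exists m.+1, (fun i => if i is j.+1 then p j else P); split=> // [[|i]//|].
  by rewrite ltnS; exact: pPol.
have Pp0 : P `<=` p 0%N by rewrite p0; exact: ext.1.
have Psub i : (i <= m)%N -> P `<=` p i.
  elim: i => // i IHi im; apply: subset_trans (IHi (ltnW im)) _.
  by have [] := pext i.+1 im.
move=> [|[|i]]// im /=; first by rewrite p0; split=> //; exact: ext.1.
have [? ? ? _ _] := pext i.+1 im.
by split=> //; apply: Psub; exact: ltnW.
Qed.

Theorem theoremC (R : realType) (k : {pred R}) (k_subfield : divring_closed k)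
    (d : nat) :
  (forall P Q : set (Rsum R), Pol k d P -> Pol k d Q ->
     (pyramidal_growth k d P Q <-> P `<=` Q)) ->
  (forall P Q : set (Rsum R), Pol k d.+1 P -> Pol k d.+1 Q ->
     (quasi_pyramidal_growth k d.+1 P Q <-> P `<=` Q)) /\
  (forall P Q : set (Rsum R), Pol k d.+1 P -> Pol k d.+1 Q -> P `<=` Q ->
     quasi_pyramidal_defect k d.+1 P Q = 0%E).
Proof.
move=> _.
have chain P Q : Pol k d.+1 P -> Pol k d.+1 Q -> P `<=` Q ->
    exists m p, quasi_pyramidal_chain k d.+1 P Q m p (fun i => p i.-1).
  move=> Pp Qp PQ; apply: pyramidal_growth_chain => //.
  exact: pyramidal_growth_incl.
split=> P Q Pp Qp; [split=> [[m [p [p' [<- <- _ pext]]]]|PQ]|move=> PQ].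
- have : forall i, (i <= m)%N -> p 0%N `<=` p i.
    elim=> [_|i IHi im x /(IHi (ltnW im)) px]; first exact: subset_refl.
    by have [_ /(_ _ px)] := pext i.+1 im.
  exact.
- by have [m [p mp]] := chain _ _ Pp Qp PQ; exists m, p, (fun i => p i.-1).
apply/eqP; rewrite eq_le; apply/andP; split.
  have [m [p mp]] := chain _ _ Pp Qp PQ.
  apply: ereal_inf_lbound; exists m, p, (fun i => p i.-1); split=> //.
  by rewrite big1// => i /asboolP[].
(* Conversely, Hausdorff distances are infima of nonnegative numbers, so every sum is
   nonnegative. *)
apply: le_ereal_inf_tmp => _ [m [p [p' [_ ->]]]]; apply: sume_ge0 => i _.
by apply: le_ereal_inf_tmp => _ [e [e0 _ _] <-]; rewrite lee_fin.
Qed.
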